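(* Let $k\in\mathbb N$, $f=\lambda z+\mathrm{h.o.t.}\in\mathcal L_k$ with $0<\lambda<1$, let $f_0$ be its normal form and $\varphi\in\mathcal L_k^0$ the unique parabolic transseries with $\varphi\circ f\circ\varphi^{-1}=f_0$. Let $h\in\mathfrak L^0$, say $h\in\mathcal L_m^0$, and let $r=\max\{k,m\}$. Then the generalized Koenigs sequence $\big(f_0^{\circ(-n)}\circ h\circ f^{\circ n}\big)_{n\in\mathbb N}$ converges to $\varphi$ in the weak topology of $\mathcal L_r$ if and only if $\mathrm{Lb}_z(h)=\mathrm{Lb}_z(\varphi)$.
   Context: $z$ infinitesimal; $\boldsymbol\ell_1:=-1/\ln z$, $\boldsymbol\ell_{j+1}:=\boldsymbol\ell_j\circ\boldsymbol\ell_1$. $\mathcal L_k$: formal sums $\sum a_{\alpha,n_1,\dots,n_k}z^\alpha\boldsymbol\ell_1^{n_1}\cdots\boldsymbol\ell_k^{n_k}$, real coefficients, well-ordered support in $\mathbb R_{\ge0}\times\mathbb Z^k$ (lexicographic); $\mathfrak L=\bigcup_k\mathcal L_k$; parabolic = leading term $z$; $\mathcal L_k^0$, $\mathfrak L^0$ the groups of parabolic elements under composition. Normal form: if $f=\lambda z+\sum_{\mathbf 0_k<\boldsymbol m\le\mathbf 1_k}a_{\boldsymbol m}z\boldsymbol\ell_1^{m_1}\cdots\boldsymbol\ell_k^{m_k}+\mathrm{h.o.t.}$ then $f_0:=\lambda z+\sum_{\mathbf 0_k<\boldsymbol m\le\mathbf 1_k}a_{\boldsymbol m}z\boldsymbol\ell_1^{m_1}\cdots\boldsymbol\ell_k^{m_k}$.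 $f_0^{\circ(-n)}$ is the $n$-th iterate of the compositional inverse of $f_0$. Blockwise writing: every $f\in\mathcal L_k$ is uniquely $f=\sum_{\alpha\in\mathrm{Supp}_z(f)}z^\alpha R_\alpha$ where $\mathrm{Supp}_z(f)\subseteq\mathbb R_{\ge0}$ is the set of exponents of $z$ occurring in $f$ and each $R_\alpha$ involves only $\boldsymbol\ell_1,\dots,\boldsymbol\ell_k$; the leading block $\mathrm{Lb}_z(f)$ is $z^{\alpha_0}R_{\alpha_0}$ with $\alpha_0=\min\mathrm{Supp}_z(f)$. Weak topology on $\mathcal L_r$: a sequence $(\varphi_n)$ converges to $\varphi$ iff for every $(\alpha,n_1,\dots,n_r)\in\mathbb R_{\ge0}\times\mathbb Z^r$ the coefficient of $z^\alpha\boldsymbol\ell_1^{n_1}\cdots\boldsymbol\ell_r^{n_r}$ in $\varphi_n$ tends (in $\mathbb R$) to that in $\varphi$. *)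

(* Defs.v *)
From Stdlib Require Import Reals.
From mathcomp Require Import all_boot all_order all_algebra.
From mathcomp Require Import boolp classical_sets fsbigop Rstruct.
Set Implicit Arguments. Unset Strict Implicit. Unset Printing Implicit Defensive.
Import GRing.Theory Num.Theory.
Local Open Scope classical_set_scope.
Local Open Scope ring_scope.

(* Monomials  z^a * l_1^{n 0} * l_2^{n 1} * ...   are encoded by (a, n) with  *)
(* a : R and n : nat -> int; the exponent of l_{j+1} is n j.  An element of   *)
(* L_k only uses monomials with n j = 0 for j >= k (i.e. only l_1..l_k).      *)
(* A (formal) series is its coefficient function.                             *)
Definition mono := (R * (nat -> int))%type.
Definition series := mono -> R.

Definition mzero : mono := (0, fun _ => 0).
Definition msub (m m1 : mono) : mono := (m.1 - m1.1, fun j => m.2 j - m1.2 j).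

Definition lexle (n p : nat -> int) : Prop :=
  n = p \/ exists j, n j < p j /\ forall i, (i < j)%N -> n i = p i.
Definition mle (m m' : mono) : Prop :=
  m.1 < m'.1 \/ (m.1 = m'.1 /\ lexle m.2 m'.2).

Definition support (f : series) : set mono := [set m | f m != 0].

Definition well_ordered (S : set mono) : Prop :=
  forall A : set mono, A `<=` S -> A !=set0 ->
    exists2 m, A m & forall m', A m' -> mle m m'.

Definition InL (k : nat) (f : series) : Prop :=
  (forall m, f m != 0 -> 0 <= m.1 /\ forall j, (k <= j)%N -> m.2 j = 0)
  /\ well_ordered (support f).

Definition lead_term_z (c : R) (f : series) : Prop :=
  f (1, fun _ => 0) = c /\ forall m, f m != 0 -> mle (1, fun _ => 0) m.

Definition parabolic (f : series) : Prop := lead_term_z 1 f.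

Definition mon (m : mono) : series := fun m' => if pselect (m' = m) then 1 else 0.
Definition sone : series := mon mzero.
Definition sadd (f g : series) : series := fun m => f m + g m.
Definition sscale (c : R) (f : series) : series := fun m => c * f m.
(* Cauchy product (finite sums for well-ordered supports) *)
Definition smul (f g : series) : series :=
  fun m => \sum_(m1 \in [set: mono]) (f m1 * g (msub m m1)).
Definition spow (f : series) (k : nat) : series := iter k (smul f) sone.
Definition ssum (I : choiceType) (F : I -> series) : series :=
  fun m => \sum_(i \in [set: I]) F i m.

Definition gbinom (a : R) (k : nat) : R :=
  (\prod_(i < k) (a - i%:R)) / (k`!)%:R.
(* (1 + x)^a  for infinitesimal x *)
Definition binser (a : R) (x : series) : series :=
  ssum (fun k : nat => sscale (gbinom a k) (spow x k)).
Definition logser (x : series) : series :=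
  ssum (fun k : nat => sscale ((-1) ^+ k / (k.+1)%:R) (spow x k.+1)).
Definition geom1 (y : series) : series := ssum (fun k : nat => spow y k.+1).

(* l_{j+1} *)
Definition ell (j : nat) : series :=
  mon (0, fun i => if i == j then 1 else 0).

(* --------- composition f o g, for g with leading term c*z (c > 0) --------- *)
(* write g = c z (1 + eps g) *)
Definition lcoef (g : series) : R := g (1, fun _ => 0).
Definition eps (g : series) : series :=
  fun m => if pselect (m = mzero) then 0
           else g (m.1 + 1, m.2) / lcoef g.
(* l_{j+1} o g = l_{j+1} (1 + delta g j) *)
Fixpoint delta (g : series) (j : nat) : series :=
  match j with
  | 0 => geom1 (smul (ell 0) (sadd (sscale (ln (lcoef g)) sone) (logser (eps g))))
  | j'.+1 => geom1 (smul (ell j'.+1) (logser (delta g j')))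
  end.

Definition nbound (n : nat -> int) : nat :=
  match pselect (exists N : nat, forall j, (N <= j)%N -> n j = 0) with
  | left P => proj1_sig (cid P)
  | right _ => 0%N
  end.

Definition mono_comp (m : mono) (g : series) : series :=
  smul (mon m)
    (smul (sscale (Rpower (lcoef g) m.1) (binser m.1 (eps g)))
          (\big[smul/sone]_(j < nbound m.2) binser (m.2 j)%:~R (delta g j))).

Definition tcomp (f g : series) : series :=
  fun m' => \sum_(m \in [set: mono]) (f m * mono_comp m g m').

Definition idz : series := mon (1, fun _ => 0).

Definition iterc (n : nat) (f : series) : series := iter n (tcomp f) idz.

Definition ones (k : nat) : nat -> int := fun j => if (j < k)%N then 1 else 0.
Definition normal_form (k : nat) (f : series) : series :=
  fun m => if pselect (m.1 = 1 /\ (forall j, (k <= j)%N -> m.2 j = 0)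
                       /\ lexle (fun _ => 0) m.2 /\ lexle m.2 (ones k))
           then f m else 0.

Definition leading_block (f : series) : series :=
  fun m => if pselect (forall m', f m' != 0 -> m.1 <= m'.1) then f m else 0.

Definition weak_cvg (r : nat) (u : nat -> series) (phi : series) : Prop :=
  forall (a : R) (n : nat -> int), 0 <= a -> (forall j, (r <= j)%N -> n j = 0) ->
    Un_cv (fun N => u N (a, n)) (phi (a, n)).

(* Main.v *)
From HB Require Import structures.
Require Import Defs.
From Stdlib Require Import Reals.
From mathcomp Require Import all_boot all_order all_algebra finmap.
From mathcomp Require Import boolp classical_sets fsbigop Rstruct.
From mathcomp Require Import cardinality functions.
From mathcomp Require Import ring lra zify.
Set Implicit Arguments. Unset Strict Implicit. Unset Printing Implicit Defensive.
Import Order.TTheory GRing.Theory Num.Theory.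
Local Open Scope classical_set_scope.
Local Open Scope ring_scope.

(** Write K = max(k, m) and z for the monomial of exponent 1. The supports of all
the series g / (c z) - 1 involved, together with l_1, .., l_K, generate a monoid P
of monomials in which every element has finitely many factorisations (Neumann's
lemma). On series supported in P infinite sums are thus finite in each
coefficient, and right composition with g = c z (1 + x) becomes a linear operator
T_g on z * R[[P]] that multiplies each monomial z^a l^n by a series with constant
term c^a, its symbol. Composition is associative, i.e. T_h T_g = T_(g o h), because
exponents and logarithms of 1 + x are multiplicative; this follows from the
coefficients of (1 + x)^a being polynomial in a.

Conjugation by phi gives T_f T_phi T_(f0^-1) = T_phi, so the n-th Koenigs element
minus phi is D_n z for D_n := T_f^n (T_h - T_phi) T_(f0^-1)^n. The entries of D_n
that raise a monomial by d, of z-exponent a, satisfy u_(n+1) = lam^a u_n plus a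
finite combination of entries raising by proper divisors of d. If the leading
blocks agree, the entries with a <= 0 vanish, and all others tend to 0 by
induction on the number of divisors of d. If they differ, they do so at a
z d with a = 0 and d minimal for divisibility, where D_n z is constant and
nonzero. *)

Lemma eq_big_uniq_supp (V : nmodType) (I : eqType) (s t : seq I) (F : I -> V) :
  uniq s -> uniq t -> (forall i, F i != 0 -> (i \in s) = (i \in t)) ->
  \sum_(i <- s) F i = \sum_(i <- t) F i.
Proof.
move=> us ut st; apply: perm_big_supp; apply: uniq_perm; rewrite ?filter_uniq // => i.
by rewrite !mem_filter; case: (boolP (F i != 0)) => //= /st.
Qed.

Lemma fsbig_uniq_supp (V : nmodType) (I : choiceType) (s : seq I) (F : I -> V) :
  uniq s -> (forall i, F i != 0 -> i \in s) ->
  \sum_(i \in [set: I]) F i = \sum_(i <- s) F i.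
Proof.
move=> us Fs; rewrite (fsbigE s) //.
  by apply: eq_bigl => i; rewrite in_setT.
by move=> i _ /negP ins; apply: contrapT => /eqP /Fs.
Qed.

(** * Series supported in a locally finite monoid *)

Record lfmonoid (G : zmodType) := LFMonoid {
  lfm_set :> G -> Prop;
  lfm0 : lfm_set 0;
  lfmD : forall a b, lfm_set a -> lfm_set b -> lfm_set (a + b);
  lfm_pointed : forall a, lfm_set a -> lfm_set (- a) -> a = 0;
  lfm_finite : forall q, finite_set [set p | lfm_set p /\ lfm_set (q - p)] }.

Section Divisors.
Variables (G : zmodType) (P : lfmonoid G).
Implicit Types p q r : G.

Definition divs q : seq G := fset_set [set p | P p /\ P (q - p)].

Lemma divs_uniq q : uniq (divs q).
Proof. exact: fset_uniq. Qed.

Lemma divsP p q : reflect (P p /\ P (q - p)) (p \in divs q).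
Proof.
have -> : p \in divs q = (p \in [set p | P p /\ P (q - p)]).
  by rewrite -in_fset_set //; apply: lfm_finite.
by apply: (iffP idP); rewrite in_setE.
Qed.

Lemma divs_trans r p q : r \in divs p -> p \in divs q -> r \in divs q.
Proof.
move=> /divsP[Pr Ppr] /divsP[Pp Pqp]; apply/divsP; split => //.
have -> : q - r = (q - p) + (p - r) by rewrite addrA subrK.
exact: lfmD.
Qed.

Lemma divs_refl q : P q -> q \in divs q.
Proof. by move=> Pq; apply/divsP; rewrite subrr; split => //; apply: lfm0. Qed.

Lemma divs_lfm p q : p \in divs q -> P q.
Proof. by move=> /divsP[Pp Pqp]; rewrite -(subrK p q); apply: lfmD. Qed.

Lemma mem0_divs q : P q -> 0 \in divs q.
Proof. by move=> Pq; apply/divsP; rewrite subr0; split => //; apply: lfm0. Qed.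

Lemma divs_subr p q : p \in divs q -> q - p \in divs q.
Proof. by move=> /divsP[Pp Pqp]; apply/divsP; rewrite subKr. Qed.

Lemma divs_anti p q : p \in divs q -> q \in divs p -> p = q.
Proof.
move=> /divsP[_ Pqp] /divsP[_]; rewrite -opprB => /(lfm_pointed Pqp) /eqP.
by rewrite subr_eq0 => /eqP.
Qed.

Lemma divs0 p : p \in divs 0 -> p = 0.
Proof. by move=> /divsP[Pp]; rewrite sub0r; apply: lfm_pointed. Qed.

Lemma leq_size_divs p q : p \in divs q -> (size (divs p) <= size (divs q))%N.
Proof.
move=> pq; apply: uniq_leq_size; first exact: divs_uniq.
by move=> r rp; apply: divs_trans pq.
Qed.

Lemma ltn_size_divs p q : p \in divs q -> p != q -> (size (divs p) < size (divs q))%N.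
Proof.
move=> pq pnq; apply: (@uniq_leq_size _ (q :: divs p)).
  rewrite /= divs_uniq andbT; apply: contra_neqN pnq; exact: divs_anti.
move=> r; rewrite inE => /predU1P[->|rp]; last exact: divs_trans pq.
exact/divs_refl/divs_lfm/pq.
Qed.

End Divisors.

Section HahnSeries.
Variables (G : zmodType) (P : lfmonoid G) (F : comNzRingType).

Definition supported_in : {pred G -> F} :=
  [pred u : G -> F | `[< forall m, ~ P m -> u m = 0 >]].

Fact supported_in_zmod_closed : zmod_closed supported_in.
Proof.
split=> [|u v /asboolP u0 /asboolP v0]; apply/asboolP => // m Pm.
by rewrite /= -[(u - v) m]/(u m - v m) u0 // v0 // subr0.
Qed.

HB.instance Definition _ :=
  GRing.isZmodClosed.Build (G -> F) supported_in supported_in_zmod_closed.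

Record hser := Hser { hcoef :> G -> F; _ : hcoef \in supported_in }.

HB.instance Definition _ := [isSub for hcoef].
HB.instance Definition _ := [Choice of hser by <:].
HB.instance Definition _ := [SubChoice_isSubZmodule of hser by <:].

Implicit Types x y w : hser.

Lemma hcoef_out x m : ~ P m -> x m = 0.
Proof. by have /asboolP := valP x; apply. Qed.

Lemma hcoef_in x m : x m != 0 -> P m.
Proof. by move=> xm; apply: contrapT => /(hcoef_out x) x0; rewrite x0 eqxx in xm. Qed.

Lemma hserP x y : (forall m, x m = y m) -> x = y.
Proof. by move=> xy; apply: val_inj; apply/funext. Qed.

Lemma hcoef0 m : (0 : hser) m = 0. Proof. by []. Qed.
Lemma hcoefD x y m : (x + y) m = x m + y m. Proof. by []. Qed.
Lemma hcoefB x y m : (x - y) m = x m - y m. Proof. by []. Qed.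

Lemma hcoef_sum (I : Type) (s : seq I) (X : I -> hser) m :
  (\sum_(i <- s) X i) m = \sum_(i <- s) X i m.
Proof. exact: (big_morph (fun x : hser => x m) (fun x y => hcoefD x y m) (hcoef0 m)). Qed.

Fact hser_of_subproof (u : G -> F) :
  {x : hser | (forall q, ~ P q -> u q = 0) -> hcoef x = u}.
Proof.
have uP : (fun m => if `[< P m >] then u m else 0) \in supported_in.
  by apply/asboolP => m Pm; rewrite asboolF.
exists (Hser uP) => u0; apply/funext => m /=.
by case: asboolP => // /u0.
Qed.

Definition hser_of (u : G -> F) : hser := sval (hser_of_subproof u).

Lemma hser_ofE u m : (forall q, ~ P q -> u q = 0) -> hser_of u m = u m.
Proof. by rewrite /hser_of; case: hser_of_subproof => x /= xu /xu ->. Qed.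

Definition hmon (p : G) : hser := hser_of (fun m => (m == p)%:R).

Lemma hmonE p m : P p -> hmon p m = (m == p)%:R.
Proof. by move=> Pp; apply: hser_ofE => q Pq; case: eqP => // qp; case: Pq; rewrite qp. Qed.

Definition hscale (a : F) x : hser := hser_of (fun m => a * x m).

Lemma hscaleE a x m : hscale a x m = a * x m.
Proof. by apply: hser_ofE => q Pq; rewrite hcoef_out ?mulr0. Qed.

Definition hmul x y : hser := hser_of (fun q => \sum_(p <- divs P q) x p * y (q - p)).

Lemma hmulE x y q : hmul x y q = \sum_(p <- divs P q) x p * y (q - p).
Proof. by apply: hser_ofE => m Pm; rewrite big_seq big1 // => p /divs_lfm. Qed.

Lemma hmul_widen x y p q : p \in divs P q ->
  hmul x y p = \sum_(s <- divs P q) x s * y (p - s).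
Proof.
move=> pq; rewrite hmulE; apply: eq_big_uniq_supp; rewrite ?divs_uniq // => s.
have [xs|/hcoef_in Ps] := eqVneq (x s) 0; first by rewrite xs mul0r eqxx.
have [ys|/hcoef_in Pps _] := eqVneq (y (p - s)) 0; first by rewrite ys mulr0 eqxx.
have sp : s \in divs P p by apply/divsP.
by rewrite sp (divs_trans sp pq).
Qed.

Fact hmulC : commutative hmul.
Proof.
move=> x y; apply: hserP => q; rewrite !hmulE.
have qK : involutive (fun p : G => q - p) by move=> p; rewrite subKr.
rewrite [RHS](eq_big_uniq_supp (t := [seq q - p | p <- divs P q])).
- by rewrite big_map; apply: eq_bigr => p _; rewrite subKr mulrC.
- exact: divs_uniq.
- by rewrite (map_inj_uniq (inv_inj qK)) divs_uniq.
move=> p _; apply/idP/mapP => [pq|[r rq ->]]; last exact: divs_subr.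
by exists (q - p); rewrite ?subKr // divs_subr.
Qed.

(* Both sides are the sum of x s * y (p - s) * w (q - p) over all s and p. *)
Fact hmulA : associative hmul.
Proof.
move=> x y w; apply: hserP => q; rewrite !hmulE.
under [RHS]eq_big_seq => p pq do rewrite (hmul_widen _ _ pq) mulr_suml.
rewrite exchange_big /=; apply: eq_big_seq => s sq.
rewrite hmulC hmulE mulr_sumr; symmetry.
transitivity (\sum_(p <- [seq q - t | t <- divs P (q - s)]) x s * y (p - s) * w (q - p)).
  apply: eq_big_uniq_supp; rewrite ?divs_uniq // ?map_inj_uniq ?divs_uniq //.
    by move=> a b /subrI.
  move=> p nz.
  have Pps : P (p - s).
    by apply: (@hcoef_in y); apply: contra_neq nz => ->; rewrite mulr0 mul0r.
  have Pqp : P (q - p) by apply: (@hcoef_in w); apply: contra_neq nz => ->; rewrite mulr0.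
  move/divsP: sq => [Ps Pqs].
  have -> : p \in divs P q by apply/divsP; split=> //; rewrite -(subrK s p); apply: lfmD.
  symmetry; apply/mapP; exists (q - p); last by rewrite subKr.
  by apply/divsP; split=> //; rewrite opprB addrC addrA subrK.
rewrite big_map; apply: eq_bigr => t _.
by rewrite subKr -mulrA [y _ * _]mulrC [q - t - s]addrAC.
Qed.

Lemma hmul_mon p y q : P p -> hmul (hmon p) y q = y (q - p).
Proof.
move=> Pp; have [Pqp|nPqp] := pselect (P (q - p)); last first.
  rewrite [RHS]hcoef_out // hmulE big1_seq // => r /andP[_ /divsP[Pr Pqr]].
  by rewrite hmonE //; case: eqP Pqr => [-> //|]; rewrite mul0r.
rewrite hmulE (bigD1_seq p) ?divs_uniq //=; last exact/divsP.
rewrite hmonE // eqxx mul1r big1 ?addr0 // => r /negPf rp.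
by rewrite hmonE // rp mul0r.
Qed.

Fact hmul1 : left_id (hmon 0) hmul.
Proof. by move=> x; apply: hserP => m; rewrite hmul_mon ?subr0 //; apply: lfm0. Qed.

Fact hmulDl : left_distributive hmul +%R.
Proof.
move=> x y w; apply: hserP => q; rewrite hcoefD !hmulE -big_split /=.
by apply: eq_bigr => p _; apply: mulrDl.
Qed.

Fact hmon0_neq0 : hmon 0 != 0.
Proof.
apply/eqP => /(congr1 (fun x : hser => x 0)) /eqP.
by rewrite hmonE ?eqxx ?oner_eq0 //; apply: lfm0.
Qed.

HB.instance Definition _ :=
  GRing.Zmodule_isComNzRing.Build hser hmulA hmulC hmul1 hmulDl hmon0_neq0.

Fact hscaleA a b x : hscale a (hscale b x) = hscale (a * b) x.
Proof. by apply: hserP => m; rewrite !hscaleE mulrA. Qed.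
Fact hscale1 : left_id 1 hscale.
Proof. by move=> x; apply: hserP => m; rewrite !hscaleE mul1r. Qed.
Fact hscaleDr : right_distributive hscale +%R.
Proof. by move=> a x y; apply: hserP => m; rewrite !(hscaleE, hcoefD) mulrDr. Qed.
Fact hscaleDl x : {morph hscale^~ x : a b / a + b}.
Proof. by move=> a b; apply: hserP => m; rewrite !(hscaleE, hcoefD) mulrDl. Qed.

HB.instance Definition _ :=
  GRing.Zmodule_isLmodule.Build F hser hscaleA hscale1 hscaleDr hscaleDl.

Fact hscaleAl (a : F) x y : a *: (x * y) = (a *: x) * y.
Proof.
apply: hserP => q; rewrite hscaleE !hmulE mulr_sumr.
by apply: eq_bigr => p _; rewrite hscaleE mulrA.
Qed.

HB.instance Definition _ := GRing.Lmodule_isLalgebra.Build F hser hscaleAl.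
HB.instance Definition _ := GRing.Lalgebra_isComAlgebra.Build F hser.

Lemma hcoefZ a x m : (a *: x) m = a * x m. Proof. exact: hscaleE. Qed.
Lemma hcoefM x y q : (x * y) q = \sum_(p <- divs P q) x p * y (q - p).
Proof. exact: hmulE. Qed.
Lemma hcoef1 m : (1 : hser) m = (m == 0)%:R.
Proof. by apply: hmonE; apply: lfm0. Qed.
Lemma hcoef_monM p y q : P p -> (hmon p * y) q = y (q - p).
Proof. exact: hmul_mon. Qed.

Lemma hmon0 : hmon 0 = 1. Proof. by []. Qed.

Lemma hmonD p q : P p -> P q -> hmon (p + q) = hmon p * hmon q.
Proof.
move=> Pp Pq; apply: hserP => m; rewrite hcoef_monM // !hmonE //; last exact: lfmD.
by rewrite subr_eq addrC.
Qed.

Lemma hcoefM0 x y : (x * y) 0 = x 0 * y 0.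
Proof.
have P0 := lfm0 P; rewrite hcoefM (bigD1_seq 0) ?divs_uniq ?mem0_divs //= subr0.
by rewrite big1_seq ?addr0 // => p /andP[/eqP p0 /divs0].
Qed.

End HahnSeries.

Section PowerSeries.
Variables (G : zmodType) (P : lfmonoid G) (F : comNzRingType).
Local Notation B := (hser P F).
Implicit Types (x y u v : B) (c : nat -> F) (p q : G).

Definition eq_below q x y := forall p, p \in divs P q -> x p = y p.

Lemma eq_below_refl q x : eq_below q x x.
Proof. by []. Qed.

Lemma eq_below_divs p q x y : p \in divs P q -> eq_below q x y -> eq_below p x y.
Proof. by move=> pq xy r rp; apply/xy/(divs_trans rp). Qed.

Lemma eq_belowM q x x' y y' :
  eq_below q x x' -> eq_below q y y' -> eq_below q (x * y) (x' * y').
Proof.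
move=> xx' yy' p pq; rewrite !hcoefM; apply: eq_big_seq => r rp.
by rewrite xx' ?(divs_trans rp) // yy' // (divs_trans (divs_subr rp)).
Qed.

Lemma eq_belowD q x x' y y' :
  eq_below q x x' -> eq_below q y y' -> eq_below q (x + y) (x' + y').
Proof. by move=> xx' yy' p pq; rewrite !hcoefD xx' ?yy'. Qed.

Lemma eq_belowZ q (a : F) x y : eq_below q x y -> eq_below q (a *: x) (a *: y).
Proof. by move=> xy p pq; rewrite !hcoefZ xy. Qed.

Lemma eq_belowX q x y k : eq_below q x y -> eq_below q (x ^+ k) (y ^+ k).
Proof.
move=> xy; elim: k => [//|k IH]; rewrite !exprS; exact: eq_belowM.
Qed.

Lemma hcoefX_eq0 x k q : x 0 = 0 -> (size (divs P q) <= k)%N -> (x ^+ k) q = 0.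
Proof.
move=> x0; elim: k q => [|k IH] q.
  rewrite leqn0 size_eq0 => /eqP dq0; rewrite expr0 hcoef_out // => /divs_refl.
  by rewrite dq0.
move=> qk; rewrite exprS hcoefM big1_seq // => p /andP[_ pq].
have [->|p0] := eqVneq p 0; first by rewrite x0 mul0r.
rewrite IH ?mulr0 // -ltnS; apply: leq_trans qk; apply: ltn_size_divs (divs_subr pq) _.
by rewrite -subr_eq0 addrC addrA addNr add0r oppr_eq0.
Qed.

(* The sum of the [c k *: x ^+ k] over all [k], meaningful when [x 0 = 0]. *)
Definition psubst c x : B :=
  hser_of P (fun q => \sum_(k < size (divs P q)) c k * (x ^+ k) q).

Lemma psubstE c x q : psubst c x q = \sum_(k < size (divs P q)) c k * (x ^+ k) q.
Proof. by apply: hser_ofE => m Pm; rewrite big1 // => i _; rewrite hcoef_out ?mulr0. Qed.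

Lemma psubst_widen c x q N : x 0 = 0 -> (size (divs P q) <= N)%N ->
  psubst c x q = \sum_(k < N) c k * (x ^+ k) q.
Proof.
move=> x0 qN; rewrite psubstE (big_ord_widen _ (fun k => c k * (x ^+ k) q) qN).
rewrite big_mkcond; apply: eq_bigr => i _; case: ltnP => // qi.
by rewrite hcoefX_eq0 ?mulr0.
Qed.

Lemma psubst_trunc c x q : x 0 = 0 ->
  eq_below q (psubst c x) (\sum_(k < size (divs P q)) c k *: x ^+ k).
Proof.
move=> x0 p pq; rewrite (psubst_widen _ x0 (leq_size_divs pq)) hcoef_sum.
by apply: eq_bigr => i _; rewrite hcoefZ.
Qed.

Lemma eq_below_psubst q c x y : eq_below q x y -> eq_below q (psubst c x) (psubst c y).
Proof.
move=> xy p pq; rewrite !psubstE; apply: eq_bigr => k _; congr (_ * _).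
exact: eq_belowX pq.
Qed.

Lemma psubst_coef0 c x : x 0 = 0 -> psubst c x 0 = c 0.
Proof.
move=> x0; rewrite psubstE; have : (0 < size (divs P 0))%N.
  by rewrite -has_predT; apply/hasP; exists 0; rewrite ?mem0_divs //; apply: lfm0.
case: size => // n _; rewrite big_ord_recl expr0 hcoef1 eqxx mulr1 big1 ?addr0 // => k _.
by rewrite exprS hcoefM0 x0 mul0r mulr0.
Qed.

Lemma psubst0 c : psubst c 0 = c 0 *: 1.
Proof.
apply: hserP => q; rewrite (psubst_widen _ _ (leqnSn _)) // big_ord_recl expr0 hcoefZ.
by rewrite big1 ?addr0 // => k _; rewrite expr0n hcoef0 mulr0.
Qed.

Definition local_linear (D : B -> B) :=
  linear D /\ forall q u v, eq_below q u v -> D u q = D v q.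

Lemma local_linear_sum D (I : Type) (s : seq I) (a : I -> F) (u : I -> B) :
  local_linear D -> D (\sum_(i <- s) a i *: u i) = \sum_(i <- s) a i *: D (u i).
Proof.
move=> [linD _]; pose L : {linear B -> B} := HB.pack D (GRing.isLinear.Build _ _ _ _ D linD).
by rewrite -[D]/(L : B -> B) linear_sum; apply: eq_bigr => i _; rewrite linearZ.
Qed.

Lemma local_linear_coef D u q : local_linear D ->
  D u q = \sum_(p <- divs P q) u p * D (hmon P F p) q.
Proof.
move=> locD; transitivity (D (\sum_(p <- divs P q) u p *: hmon P F p) q).
  apply: locD.2 => r rq; rewrite hcoef_sum (bigD1_seq r) ?divs_uniq //=.
  have [Pr _] := divsP P _ _ rq.
  rewrite hcoefZ hmonE // eqxx mulr1 big1_seq ?addr0 // => p /andP[/negPf pr /divsP[Pp _]].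
  by rewrite hcoefZ hmonE // eq_sym pr mulr0.
by rewrite local_linear_sum // hcoef_sum; apply: eq_bigr => p _; rewrite hcoefZ.
Qed.

Lemma local_linear_ext D E : local_linear D -> local_linear E ->
  (forall p, P p -> D (hmon P F p) = E (hmon P F p)) -> D =1 E.
Proof.
move=> locD locE DE u; apply: hserP => q; rewrite !(local_linear_coef u q) //.
by apply: eq_big_seq => p /divsP[/DE -> _].
Qed.

Lemma local_linear_comp D E :
  local_linear D -> local_linear E -> local_linear (fun u => D (E u)).
Proof.
move=> [linD locD] [linE locE]; split=> [a u v|q u v uv]; first by rewrite linE linD.
by apply: locD => p pq; apply/locE/(eq_below_divs pq).
Qed.

Lemma local_linear_mull y : local_linear ( *%R y).
Proof.
split=> [a u v|q u v uv]; first by rewrite mulrDr scalerAr.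
have [Pq|nPq] := pselect (P q); last by rewrite !hcoef_out.
exact: (eq_belowM (@eq_below_refl q y) uv (divs_refl Pq)).
Qed.

Lemma local_linear_mulr y : local_linear ( *%R^~ y).
Proof.
rewrite (_ : ( *%R^~ y) = *%R y); first exact: local_linear_mull.
by apply/funext => u; rewrite mulrC.
Qed.

Lemma local_linear_psubst D c x : local_linear D -> {morph D : u v / u * v} ->
  D 1 = 1 -> x 0 = 0 -> D (psubst c x) = psubst c (D x).
Proof.
move=> locD DM D1 x0.
have DX k : D (x ^+ k) = D x ^+ k by elim: k => [//|k IH]; rewrite !exprS DM IH.
apply: hserP => q; rewrite (locD.2 _ _ _ (@psubst_trunc c x q x0)).
rewrite local_linear_sum // hcoef_sum psubstE.
by apply: eq_bigr => k _; rewrite hcoefZ DX.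
Qed.

End PowerSeries.

Section MonomialSubstitution.
Variables (G : zmodType) (P : lfmonoid G) (F : comNzRingType).
Local Notation B := (hser P F).
Local Notation mon := (hmon P F).
Implicit Types (u v : B) (U V a b c e : G -> B) (p q r s d : G).

Definition hsubst U u : B :=
  hser_of P (fun q => \sum_(p <- divs P q) u p * U p (q - p)).

Lemma hsubstE U u q : hsubst U u q = \sum_(p <- divs P q) u p * U p (q - p).
Proof. by apply: hser_ofE => m Pm; rewrite big1_seq // => p /andP[_ /divs_lfm]. Qed.

Lemma hsubst_local U : local_linear (hsubst U).
Proof.
split=> [a u v|q u v uv]; last by rewrite !hsubstE; apply: eq_big_seq => p /uv ->.
apply: hserP => q; rewrite hcoefD hcoefZ !hsubstE mulr_sumr -big_split.
by apply: eq_bigr => p _; rewrite hcoefD hcoefZ mulrDl mulrA.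
Qed.

HB.instance Definition _ U := GRing.isLinear.Build F B B *:%R (hsubst U) (hsubst_local U).1.

Lemma eq_hsubst U V : U =1 V -> hsubst U =1 hsubst V.
Proof. by move=> /funext ->. Qed.

Lemma hsubst_mon U p : P p -> hsubst U (mon p) = mon p * U p.
Proof.
move=> Pp; apply: hserP => q; rewrite hsubstE hcoef_monM //.
have [pq|pq] := boolP (p \in divs P q).
  rewrite (bigD1_seq p) ?divs_uniq //= hmonE // eqxx mul1r big1 ?addr0 //.
  by move=> r /negPf rp; rewrite hmonE // rp mul0r.
rewrite hcoef_out; last by move=> Pqp; case/divsP: pq.
rewrite big1_seq // => r /andP[_ rq]; rewrite hmonE //.
by case: eqP rq pq => [-> ->|]; rewrite ?mul0r.
Qed.

Lemma hsubst1 U : hsubst U 1 = U 0.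
Proof. by rewrite -(hmon0 P F) hsubst_mon ?mul1r //; apply: lfm0. Qed.

Lemma hsubst_coef0 U u : hsubst U u 0 = u 0 * U 0 0.
Proof.
have P0 := lfm0 P; rewrite hsubstE (bigD1_seq 0) ?divs_uniq ?mem0_divs //= subr0.
by rewrite big1_seq ?addr0 // => p /andP[/eqP p0 /divs0].
Qed.

Lemma hsubstB U V u : hsubst (fun p => U p - V p) u = hsubst U u - hsubst V u.
Proof.
apply: hserP => q; rewrite hcoefB !hsubstE -sumrB.
by apply: eq_bigr => p _; rewrite hcoefB mulrBr.
Qed.

Lemma hsubst_monM U p v : P p ->
  hsubst U (mon p * v) = mon p * hsubst (fun s => U (p + s)) v.
Proof.
move=> Pp; move: v.
apply: (local_linear_ext (local_linear_comp (hsubst_local _) (local_linear_mull _))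
          (local_linear_comp (local_linear_mull _) (hsubst_local _))) => q Pq.
by rewrite -hmonD // !hsubst_mon //; [rewrite hmonD // mulrA|apply: lfmD].
Qed.

Definition symbol_comp a c p : B := hsubst (fun s => a (p + s)) (c p).

Lemma hsubst_comp a c u : hsubst a (hsubst c u) = hsubst (symbol_comp a c) u.
Proof.
move: u; apply: (local_linear_ext (local_linear_comp (hsubst_local a) (hsubst_local c))
                   (hsubst_local _)) => p Pp.
by rewrite !hsubst_mon // hsubst_monM.
Qed.

Section Multiplicative.
Variable U : G -> B.
Hypothesis UD : forall p q, U (p + q) = U p * U q.

Lemma hsubst_shift p u : hsubst (fun s => U (p + s)) u = U p * hsubst U u.
Proof.
move: u; apply: (local_linear_ext (hsubst_local _)
                   (local_linear_comp (local_linear_mull _) (hsubst_local U))) => q Pq.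
by rewrite !hsubst_mon // UD mulrCA.
Qed.

Lemma hsubstM : {morph hsubst U : u v / u * v}.
Proof.
move=> u v; move: u.
apply: (local_linear_ext (local_linear_comp (hsubst_local U) (local_linear_mulr v))
          (local_linear_comp (local_linear_mulr (hsubst U v)) (hsubst_local U))) => p Pp.
by rewrite hsubst_monM // hsubst_shift mulrA hsubst_mon.
Qed.

Lemma hsubst_psubst (c : nat -> F) u : U 0 = 1 -> u 0 = 0 ->
  hsubst U (psubst c u) = psubst c (hsubst U u).
Proof.
move=> U0 u0; apply: local_linear_psubst => //; [exact: hsubst_local|exact: hsubstM|].
by rewrite hsubst1.
Qed.

End Multiplicative.

Section Conjugation.
Variables a b e : G -> B.

Fixpoint conj_symbol n : G -> B :=
  if n is n'.+1 then symbol_comp a (symbol_comp (conj_symbol n') b) else e.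

Lemma hsubst_conj_symbol n u :
  hsubst (conj_symbol n) u = iter n (hsubst a) (hsubst e (iter n (hsubst b) u)).
Proof. by elim: n u => //= n IH u; rewrite -!hsubst_comp IH -iterSr. Qed.

Lemma conj_symbolS n p d : conj_symbol n.+1 p d =
  \sum_(s <- divs P d) \sum_(r <- divs P s)
    b p r * conj_symbol n (p + r) (s - r) * a (p + s) (d - s).
Proof.
by rewrite hsubstE; apply: eq_bigr => s _; rewrite hsubstE mulr_suml.
Qed.

Lemma conj_symbol_rec n p d : conj_symbol n.+1 p d =
  (b p 0 * a (p + d) 0) * conj_symbol n p d +
  \sum_(s <- divs P d) \sum_(r <- divs P s | s - r != d)
    b p r * conj_symbol n (p + r) (s - r) * a (p + s) (d - s).
Proof.
rewrite conj_symbolS.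
have [Pd|nPd] := pselect (P d); last first.
  rewrite [conj_symbol n p d]hcoef_out // mulr0 add0r.
  by rewrite !big1_seq // => s /andP[_ /divs_lfm].
under eq_bigr => s _ do rewrite (bigID (fun r => s - r == d)) /=.
rewrite big_split /=; congr (_ + _).
rewrite (bigD1_seq d) ?divs_uniq ?divs_refl //= [X in _ + X]big1_seq ?addr0.
  rewrite (eq_bigl (pred1 0)) => [|r]; last first.
    by rewrite subr_eq -[X in X == _]addr0 (inj_eq (addrI d)) eq_sym.
  rewrite -big_filter filter_pred1_uniq ?divs_uniq ?mem0_divs // big_seq1.
  by rewrite addr0 !subr0 subrr mulrAC.
move=> s /andP[/eqP sd ds]; rewrite big1_seq // => r /andP[/eqP srd /divs_subr].
by rewrite srd => /(divs_anti ds).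
Qed.

(* If [e] vanishes strictly below [d], so does every iterate, and at [d] the
   recursion reduces to its diagonal term. *)
Lemma conj_symbol_minimal n p d :
  (forall q s, s \in divs P d -> s != d -> e q s = 0) ->
  conj_symbol n p d = (b p 0 * a (p + d) 0) ^+ n * e p d.
Proof.
elim: n p d => [|n IH] p d e0; first by rewrite mul1r.
rewrite conj_symbol_rec IH // exprS -[RHS]mulrA [X in _ + X]big1_seq ?addr0 // => s /andP[_ sd].
rewrite big1_seq // => r /andP[srd rs].
have tsd := divs_trans (divs_subr rs) sd.
rewrite IH ?e0 ?mulr0 ?mul0r // => q t tsr _; rewrite e0 ?(divs_trans tsr) //.
by apply: contraNneq srd => td; apply/eqP/(divs_anti tsd); rewrite -td.
Qed.

End Conjugation.
End MonomialSubstitution.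

(** * Binomial series, logarithm and geometric series *)

Section BinomialPolynomials.
Variable F : numFieldType.

Definition binom_poly k : {poly F} := k`!%:R^-1 *: \prod_(i < k) ('X - i%:R%:P).

Lemma horner_binom_poly k a : (binom_poly k).[a] = (\prod_(i < k) (a - i%:R)) / k`!%:R.
Proof.
rewrite hornerZ horner_prod mulrC; congr (_ * _).
by apply: eq_bigr => i _; rewrite !hornerE.
Qed.

Lemma binom_poly0 : binom_poly 0 = 1.
Proof. by rewrite /binom_poly big_ord0 fact0 invr1 scale1r. Qed.

Lemma horner_binom_poly_nat n k : (binom_poly k).[n%:R] = 'C(n, k)%:R.
Proof.
have fact_neq0 : k`!%:R != 0 :> F by rewrite pnatr_eq0 -lt0n fact_gt0.
apply: (mulIf fact_neq0); rewrite horner_binom_poly divfK // -natrM bin_ffact.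
elim: k {fact_neq0} => [|k IH]; first by rewrite big_ord0 ffactn0.
rewrite big_ord_recr /= IH ffactnSr natrM.
have [kn|nk] := leqP k n; first by rewrite natrB.
by rewrite ffact_small // !mul0r.
Qed.

Lemma coef1_binom_poly k : (binom_poly k.+1)`_1 = (-1) ^+ k / k.+1%:R.
Proof.
rewrite /binom_poly coefZ big_ord_recl /= subr0 coefXM /= -horner_coef0 horner_prod.
under eq_bigr => i _ do rewrite !hornerE /bump /= add1n -mulN1r.
rewrite big_split /= prodr_const card_ord.
have -> : \prod_(i < k) (i.+1%:R : F) = k`!%:R.
  by rewrite fact_prod big_add1 /= big_mkord natr_prod.
rewrite factS natrM invfM mulrC -!mulrA; congr (_ * _).
by rewrite mulrCA divff ?mulr1 // pnatr_eq0 -lt0n fact_gt0.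
Qed.

Lemma eq_poly_nat (p r : {poly F}) : (forall n : nat, p.[n%:R] = r.[n%:R]) -> p = r.
Proof.
move=> pr; apply/eqP; rewrite -subr_eq0; apply/eqP.
apply: (@roots_geq_poly_eq0 _ _ [seq n%:R | n <- iota 0 (size (p - r))]).
- by apply/allP => _ /mapP[n _ ->]; rewrite rootE hornerD hornerN pr subrr.
- by rewrite map_inj_uniq ?iota_uniq // => a b /eqP; rewrite eqr_nat => /eqP.
- by rewrite size_map size_iota.
Qed.

End BinomialPolynomials.

Section ElementaryFunctions.
Variables (G : zmodType) (P : lfmonoid G) (F : numFieldType).
Local Notation B := (hser P F).
Implicit Types (x y u v : B) (a b : F).

Definition hbinom a x := psubst (fun k => (binom_poly F k).[a]) x.

(* The coefficients of [ln (1 + x)] are the derivatives at [a = 0] of those of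
   [(1 + x)^a]. *)
Definition hlog x := psubst (fun k => (binom_poly F k)`_1) x.

Definition hgeom x := psubst (fun k => (0 < k)%:R) x.

Definition hbinom_poly x q : {poly F} :=
  \sum_(k < size (divs P q)) (x ^+ k) q *: binom_poly F k.

Lemma horner_hbinom_poly a x q : (hbinom_poly x q).[a] = hbinom a x q.
Proof.
rewrite psubstE horner_sum; apply: eq_bigr => i _.
by rewrite hornerZ mulrC.
Qed.

Lemma coef1_hbinom_poly x q : (hbinom_poly x q)`_1 = hlog x q.
Proof.
rewrite psubstE /hbinom_poly coef_sum; apply: eq_bigr => i _.
by rewrite [LHS]coefZ mulrC.
Qed.

Lemma hbinom_nat (n : nat) x : x 0 = 0 -> hbinom n%:R x = (1 + x) ^+ n.
Proof.
move=> x0; apply: hserP => q.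
rewrite (psubst_widen _ x0 (leq_maxl (size (divs P q)) n.+1)).
rewrite exprDn (big_ord_widen _ (fun k => 1 ^+ (n - k) * x ^+ k *+ 'C(n, k))
  (leq_maxr (size (divs P q)) n.+1)) [in RHS]big_mkcond hcoef_sum.
apply: eq_bigr => i _; rewrite horner_binom_poly_nat; case: ltnP => ni.
  by rewrite expr1n mul1r -scaler_nat hcoefZ.
by rewrite bin_small // mul0r hcoef0.
Qed.

Lemma hbinom0 x : hbinom 0 x = 1.
Proof.
apply: hserP => q; rewrite psubstE; under eq_bigr do rewrite (horner_binom_poly_nat F 0).
case sz: (size _) => [|n]; last first.
  by rewrite big_ord_recl mul1r big1 ?addr0 // => k _; rewrite bin_small ?mul0r.
rewrite big_ord0 hcoef_out // => /divs_refl.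
by rewrite (size0nil sz).
Qed.

Lemma hbinom1 x : x 0 = 0 -> hbinom 1 x = 1 + x.
Proof. by move=> /(hbinom_nat 1) ->. Qed.

Lemma hbinom_coef0 a x : x 0 = 0 -> hbinom a x 0 = 1.
Proof. by move=> x0; rewrite psubst_coef0 // binom_poly0 hornerC. Qed.

Definition qmul x y : B := x + y + x * y.

Lemma qmulE x y : 1 + qmul x y = (1 + x) * (1 + y).
Proof. by rewrite /qmul; ring. Qed.

Lemma qmul_coef0 x y : x 0 = 0 -> y 0 = 0 -> qmul x y 0 = 0.
Proof. by move=> x0 y0; rewrite !hcoefD hcoefM0 x0 y0 mul0r !addr0. Qed.

Lemma hbinom_poly_qmul x y q : x 0 = 0 -> y 0 = 0 ->
  hbinom_poly (qmul x y) q = \sum_(p <- divs P q) hbinom_poly x p * hbinom_poly y (q - p).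
Proof.
move=> x0 y0; apply: eq_poly_nat => n.
rewrite horner_hbinom_poly hbinom_nat ?qmul_coef0 // qmulE exprMn -!hbinom_nat //.
by rewrite hcoefM horner_sum; apply: eq_bigr => p _; rewrite hornerM !horner_hbinom_poly.
Qed.

Lemma hbinom_qmul a x y : x 0 = 0 -> y 0 = 0 ->
  hbinom a (qmul x y) = hbinom a x * hbinom a y.
Proof.
move=> x0 y0; apply: hserP => q.
rewrite -horner_hbinom_poly hbinom_poly_qmul // horner_sum hcoefM.
by apply: eq_bigr => p _; rewrite hornerM !horner_hbinom_poly.
Qed.

Lemma hlog_qmul x y : x 0 = 0 -> y 0 = 0 -> hlog (qmul x y) = hlog x + hlog y.
Proof.
have coef0 u p : (hbinom_poly u p)`_0 = (1 : B) p.
  by rewrite -horner_coef0 horner_hbinom_poly hbinom0.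
move=> x0 y0; rewrite -[in RHS](mulr1 (hlog x)) -[in RHS](mul1r (hlog y)).
apply: hserP => q; rewrite -coef1_hbinom_poly hbinom_poly_qmul // coef_sum.
rewrite hcoefD !hcoefM -big_split; apply: eq_bigr => p _ /=.
by rewrite coefM !big_ord_recl big_ord0 addr0 addrC !coef0 !coef1_hbinom_poly.
Qed.

(* Both sides have coefficients polynomial in [a] and in [b], so it is enough to
   compare them at natural exponents, one variable at a time. *)
Lemma hbinomD a b x : x 0 = 0 -> hbinom (a + b) x = hbinom a x * hbinom b x.
Proof.
move=> x0.
have nat_enough c : (forall n : nat, hbinom (n%:R + c) x = hbinom n%:R x * hbinom c x) ->
    forall d, hbinom (d + c) x = hbinom d x * hbinom c x.
  move=> atnat d; apply: hserP => q.
  pose lhs : {poly F} := hbinom_poly x q \Po ('X + c%:P).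
  pose rhs : {poly F} := \sum_(p <- divs P q) hbinom c x (q - p) *: hbinom_poly x p.
  have lhsE e : lhs.[e] = hbinom (e + c) x q.
    by rewrite horner_comp !hornerE horner_hbinom_poly.
  have rhsE e : rhs.[e] = (hbinom e x * hbinom c x) q.
    rewrite horner_sum hcoefM; apply: eq_bigr => p _.
    by rewrite hornerZ horner_hbinom_poly mulrC.
  rewrite -lhsE -rhsE; congr (_.[d]).
  by apply: eq_poly_nat => n; rewrite lhsE rhsE atnat.
apply: (nat_enough) => n; rewrite addrC mulrC; apply: nat_enough => k.
by rewrite -natrD !hbinom_nat // exprD.
Qed.

Lemma hgeom_coef0 x : x 0 = 0 -> hgeom x 0 = 0.
Proof. exact: psubst_coef0. Qed.

Lemma hgeomP x y : x 0 = 0 -> y = hgeom x <-> (1 - x) * (1 + y) = 1.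
Proof.
move=> x0; have geomK : (1 - x) * (1 + hgeom x) = 1.
  apply: hserP => q; have [Pq|nPq] := pselect (P q); last by rewrite !hcoef_out.
  have trunc : eq_below q (1 + hgeom x) (\sum_(k < size (divs P q)) x ^+ k).
    move=> p pq; rewrite hcoefD (psubst_widen _ x0 (leq_size_divs pq)) hcoef_sum.
    have : (0 < size (divs P q))%N by case: (divs P q) pq.
    case: (size _) => // n _; rewrite !big_ord_recl /= mul0r add0r; congr (_ + _).
    by apply: eq_bigr => i _; rewrite mul1r.
  rewrite ((local_linear_mull _).2 _ _ _ trunc) -opprB mulNr -subrX1 opprB.
  by rewrite hcoefB (hcoefX_eq0 x0 (leqnn _)) subr0.
split=> [-> //|yK]; apply: (addrI 1).
have -> : 1 + y = (1 - x) * (1 + hgeom x) * (1 + y) by rewrite geomK mul1r.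
by rewrite mulrAC yK mul1r.
Qed.

End ElementaryFunctions.

(** * Composition operators *)

Section Composition.
Variables (P : lfmonoid mono) (K : nat).
Local Notation B := (hser P R).
Local Notation mon := (hmon P R).

Definition ell_mono (j : nat) : mono := (0, fun i => if i == j then 1 else 0).
Definition z_mono : mono := (1, fun _ => 0).

Hypothesis ellP : forall j, (j < K)%N -> P (ell_mono j).

Implicit Types (x y u v : B) (c d : R) (m : mono).

Lemma ell_mono_neq0 j : ell_mono j != 0.
Proof. by apply/eqP => /(congr1 (fun m : mono => m.2 j)) /=; rewrite eqxx => /eqP. Qed.

Lemma mon_ellM_coef0 j u : (j < K)%N -> (mon (ell_mono j) * u) 0 = 0.
Proof.
by move=> /ellP Pj; rewrite hcoefM0 hmonE // eq_sym (negPf (ell_mono_neq0 j)) mul0r.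
Qed.

(* For g = c z (1 + x), [hdelta c x j] is [delta g j], and [comp_factor c x m] is
   [mono_comp m g] divided by the monomial m. *)
Fixpoint hdelta c x (j : nat) : B :=
  match j with
  | 0 => hgeom (mon (ell_mono 0) * (ln c *: 1 + hlog x))
  | j'.+1 => hgeom (mon (ell_mono j'.+1) * hlog (hdelta c x j'))
  end.

Definition comp_factor c x m : B :=
  Rpower c m.1 *: (hbinom m.1 x * \prod_(j < K) hbinom (m.2 j)%:~R (hdelta c x j)).

Local Notation hcomp c x := (hsubst (comp_factor c x)).

(* [z * zcomp c x u] is the composition of z u with c z (1 + x). *)
Definition zcomp c x : B -> B := hsubst (fun p => comp_factor c x (z_mono + p)).

Lemma hdelta_coef0 c x j : (j < K)%N -> hdelta c x j 0 = 0.
Proof. by case: j => [|j] jK; apply/hgeom_coef0/mon_ellM_coef0. Qed.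

Lemma comp_factorD c x m1 m2 : x 0 = 0 ->
  comp_factor c x (m1 + m2) = comp_factor c x m1 * comp_factor c x m2.
Proof.
move=> x0; rewrite /comp_factor /= Rpower_plus -[Rmult _ _]/(_ * _ : R) hbinomD //.
under eq_bigr => j _ do
  rewrite -[(m1.2 + m2.2) (nat_of_ord j)]/(m1.2 j + m2.2 j) intrD hbinomD ?hdelta_coef0 //.
by rewrite big_split -scalerAl -scalerAr scalerA /=; congr (_ *: _); ring.
Qed.

Lemma comp_factor0 c x : 0 < c -> comp_factor c x 0 = 1.
Proof.
move=> /RltP c_gt0; rewrite /comp_factor /= Rpower_O // scale1r hbinom0 mul1r.
by rewrite big1 // => j _; rewrite hbinom0.
Qed.

Lemma comp_factor_coef0 c x m : x 0 = 0 -> comp_factor c x m 0 = Rpower c m.1.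
Proof.
move=> x0; rewrite hcoefZ hcoefM0 hbinom_coef0 // mul1r.
rewrite (big_ind (fun w : B => w 0 = 1)) ?mulr1 ?hcoef1 ?eqxx //.
- by move=> u v u0 v0; rewrite hcoefM0 u0 v0 mulr1.
- by move=> j _; rewrite hbinom_coef0 // hdelta_coef0.
Qed.

Lemma comp_factor_z c x : 0 < c -> x 0 = 0 -> comp_factor c x z_mono = c *: (1 + x).
Proof.
move=> /RltP c_gt0 x0; rewrite /comp_factor /= Rpower_1 // hbinom1 // big1 ?mulr1 // => j _.
by rewrite hbinom0.
Qed.

Lemma comp_factor_ell c x j : 0 < c -> (j < K)%N ->
  comp_factor c x (ell_mono j) = 1 + hdelta c x j.
Proof.
move=> /RltP c_gt0 jK; rewrite /comp_factor /= Rpower_O // scale1r hbinom0 mul1r.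
rewrite (bigD1 (Ordinal jK)) //= eqxx hbinom1 ?hdelta_coef0 // big1 ?mulr1 // => i ij.
by rewrite (_ : (i == j :> nat) = false) ?hbinom0 //; apply: negPf.
Qed.

Lemma hcompM c x : x 0 = 0 -> {morph hcomp c x : u v / u * v}.
Proof. by move=> x0; apply: hsubstM => p q; apply: comp_factorD. Qed.

Lemma hcomp1 c x : 0 < c -> hcomp c x 1 = 1.
Proof. by move=> c_gt0; rewrite hsubst1 comp_factor0. Qed.

Lemma hcomp_psubst c x (a : nat -> R) u : 0 < c -> x 0 = 0 -> u 0 = 0 ->
  hcomp c x (psubst a u) = psubst a (hcomp c x u).
Proof.
move=> c_gt0 x0; apply: hsubst_psubst; last exact: comp_factor0.
by move=> p q; apply: comp_factorD.
Qed.

Lemma hcomp_hbinom c x (a : R) u : 0 < c -> x 0 = 0 -> u 0 = 0 ->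
  hcomp c x (hbinom a u) = hbinom a (hcomp c x u).
Proof. exact: hcomp_psubst. Qed.

Lemma hcomp_hlog c x u : 0 < c -> x 0 = 0 -> u 0 = 0 ->
  hcomp c x (hlog u) = hlog (hcomp c x u).
Proof. exact: hcomp_psubst. Qed.

Lemma hcomp_hgeom c x u : 0 < c -> x 0 = 0 -> u 0 = 0 ->
  hcomp c x (hgeom u) = hgeom (hcomp c x u).
Proof. exact: hcomp_psubst. Qed.

Lemma hcomp_coef0 c x u : u 0 = 0 -> hcomp c x u 0 = 0.
Proof. by move=> u0; rewrite hsubst_coef0 u0 mul0r. Qed.

Section ChainRule.
Variables (c d : R) (x y : B).
Hypotheses (c_gt0 : 0 < c) (d_gt0 : 0 < d) (x0 : x 0 = 0) (y0 : y 0 = 0).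
Local Notation T := (hcomp d y).
Local Notation xy := (qmul y (T x)).

Lemma qmul_hcomp_coef0 : xy 0 = 0.
Proof. by apply: qmul_coef0 => //; apply: hcomp_coef0. Qed.

Lemma hcomp_hgeom_ell j v : (j < K)%N ->
  T (hgeom (mon (ell_mono j) * v)) = hgeom (mon (ell_mono j) * (1 + hdelta d y j) * T v).
Proof.
move=> jK; rewrite (hcomp_hgeom d_gt0 y0 (mon_ellM_coef0 v jK)) (hcompM d y0).
by rewrite (hsubst_mon _ (ellP jK)) (comp_factor_ell y d_gt0 jK).
Qed.

(* If 1 + s = 1 / (1 - e v) and 1 + s' = 1 / (1 - e (1 + s) v'), then
   (1 + s) (1 + s') = 1 / (1 - e (v + v')). *)
Lemma qmul_hdelta_hgeom j v v' : (j < K)%N ->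
  hdelta d y j = hgeom (mon (ell_mono j) * v) ->
  hdelta c x j = hgeom (mon (ell_mono j) * v') ->
  qmul (hdelta d y j) (T (hdelta c x j)) = hgeom (mon (ell_mono j) * (v + T v')).
Proof.
move=> jK dE cE; have ell_coef0 w : (mon (ell_mono j) * w) 0 = 0 by apply: mon_ellM_coef0.
apply/(hgeomP _ (ell_coef0 _)); rewrite qmulE; have /(hgeomP _ (ell_coef0 _)) dK := dE.
have TcE : T (hdelta c x j) = hgeom (mon (ell_mono j) * (1 + hdelta d y j) * T v').
  by rewrite cE (hcomp_hgeom_ell v' jK).
have Tell_coef0 : (mon (ell_mono j) * (1 + hdelta d y j) * T v') 0 = 0 by rewrite -mulrA ell_coef0.
have TcK := (hgeomP _ Tell_coef0).1 TcE.
transitivity (((1 - mon (ell_mono j) * v) * (1 + hdelta d y j)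
  - mon (ell_mono j) * (1 + hdelta d y j) * T v') * (1 + T (hdelta c x j))); first by ring.
by rewrite dK TcK.
Qed.

Lemma hdelta_chain j : (j < K)%N ->
  hdelta (c * d) xy j = qmul (hdelta d y j) (T (hdelta c x j)).
Proof.
elim: j => [|j IH] jK; rewrite (qmul_hdelta_hgeom jK (erefl _) (erefl _)) /=.
  congr (hgeom (_ * _)); rewrite hlog_qmul ?hcomp_coef0 //.
  have -> : ln (c * d) = ln c + ln d by apply: ln_mult; apply/RltP.
  by rewrite linearD linearZ /= hcomp1 // hcomp_hlog // scalerDl; ring.
have jK' : (j < K)%N := ltnW jK.
by rewrite IH // hlog_qmul ?hcomp_hlog ?hcomp_coef0 ?hdelta_coef0.
Qed.

Lemma comp_factor_chain m :
  comp_factor (c * d) xy m = comp_factor d y m * T (comp_factor c x m).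
Proof.
rewrite /comp_factor linearZ /= hcompM // (big_morph T (hcompM d y0) (hcomp1 y d_gt0)).
rewrite hbinom_qmul ?hcomp_coef0 // [T (hbinom m.1 x)]hcomp_hbinom //.
under eq_bigr => j _ do rewrite hdelta_chain // hbinom_qmul ?hcomp_coef0 ?hdelta_coef0 //.
under [X in _ = _ * (_ *: (_ * X))]eq_bigr => j _ do rewrite hcomp_hbinom ?hdelta_coef0 //.
have -> : Rpower (c * d) m.1 = Rpower c m.1 * Rpower d m.1.
  by symmetry; apply: Rpower_mult_distr; apply/RltP.
rewrite big_split -scalerAl -scalerAr scalerA [in RHS](mulrC (Rpower d _)) /=.
by congr (_ *: _); ring.
Qed.

Lemma zcompE u : zcomp d y u = comp_factor d y z_mono * T u.
Proof. by apply: hsubst_shift => p q; apply: comp_factorD. Qed.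

Lemma zcomp_comp u : zcomp d y (zcomp c x u) = zcomp (c * d) xy u.
Proof.
rewrite [LHS]hsubst_comp; apply: eq_hsubst => p; rewrite comp_factor_chain.
rewrite -(hsubst_shift (fun m1 m2 => comp_factorD d m1 m2 y0)).
by apply: eq_hsubst => s; rewrite addrA.
Qed.

Lemma zcomp_affine : zcomp d y (c *: (1 + x)) = (c * d) *: (1 + xy).
Proof.
rewrite zcompE comp_factor_z // [T _]linearZ /= [T _]linearD /= hcomp1 // qmulE.
by rewrite -scalerAl -scalerAr scalerA mulrC.
Qed.

End ChainRule.

Lemma zcomp1 c x : 0 < c -> x 0 = 0 -> zcomp c x 1 = c *: (1 + x).
Proof. by move=> c_gt0 x0; rewrite /zcomp hsubst1 addr0 comp_factor_z. Qed.

Lemma comp_factor_id m : comp_factor 1 0 m = 1.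
Proof.
have binom0 a : hbinom a (0 : B) = 1 by rewrite [LHS]psubst0 binom_poly0 hornerC scale1r.
have log0 : hlog (0 : B) = 0 by rewrite [LHS]psubst0 binom_poly0 coef1 scale0r.
have geom0 : hgeom (0 : B) = 0 by rewrite [LHS]psubst0 scale0r.
have delta0 j : hdelta 1 (0 : B) j = 0.
  elim: j => [|j IH] /=; rewrite ?IH log0 ?mulr0 ?geom0 // ln_1.
  by rewrite -[IZR 0]/(0 : R) scale0r addr0 mulr0 geom0.
rewrite /comp_factor binom0 mul1r big1; last by move=> j _; rewrite delta0 binom0.
by rewrite /Rpower ln_1 Rmult_0_r exp_0 scale1r.
Qed.

Lemma zcomp_id : zcomp 1 0 =1 id.
Proof.
move=> u; apply: hserP => q; rewrite hsubstE.
have [Pq|nPq] := pselect (P q); last first.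
  by rewrite hcoef_out // big1_seq // => p /andP[_ /divs_lfm].
rewrite (bigD1_seq q) ?divs_uniq ?divs_refl //= comp_factor_id subrr hcoef1 eqxx mulr1.
rewrite big1 ?addr0 // => p pq.
by rewrite comp_factor_id hcoef1 subr_eq0 eq_sym (negPf pq) mulr0.
Qed.

Lemma eq_below_hdelta q c x y j :
  eq_below q x y -> eq_below q (hdelta c x j) (hdelta c y j).
Proof.
move=> xy; elim: j => [|j IH] /=; apply/eq_below_psubst/eq_belowM.
- exact: eq_below_refl.
- by apply: eq_belowD; [apply: eq_below_refl|apply: eq_below_psubst].
- exact: eq_below_refl.
- exact: eq_below_psubst.
Qed.

Lemma eq_below_comp_factor q c x y m :
  eq_below q x y -> eq_below q (comp_factor c x m) (comp_factor c y m).
Proof.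
move=> xy; apply/eq_belowZ/eq_belowM; first exact: eq_below_psubst.
apply: (big_ind2 (eq_below q)) => [|u u' v v' uu' vv'|j _].
- exact: eq_below_refl.
- exact: eq_belowM.
- exact/eq_below_psubst/eq_below_hdelta.
Qed.

End Composition.

(** * Transseries as shifted Hahn series *)

Lemma eq_big_ord_idx (T : Type) (idx : T) (op : Monoid.law idx) (n k : nat) (W : nat -> T) :
  (forall j, (n <= j)%N -> W j = idx) -> (forall j, (k <= j)%N -> W j = idx) ->
  \big[op/idx]_(j < n) W j = \big[op/idx]_(j < k) W j.
Proof.
move=> nW kW; rewrite (big_ord_widen _ W (leq_maxl n k)) big_mkcond.
rewrite [RHS](big_ord_widen _ W (leq_maxr n k)) [RHS]big_mkcond.
by apply: eq_bigr => j _; case: ltnP => [_|/nW ->]; case: ltnP => // /kW.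
Qed.

Lemma mon_eqE (v m : mono) : Defs.mon v m = (m == v)%:R.
Proof. by rewrite /Defs.mon; case: pselect => /= [->|/eqP/negPf ->]; rewrite ?eqxx. Qed.

Lemma gbinomE a k : gbinom a k = (binom_poly R k).[a].
Proof. by rewrite horner_binom_poly. Qed.

Lemma binser0 s : binser 0 s = sone.
Proof.
apply/funext => m; rewrite /binser /ssum (fsbig_uniq_supp (s := [:: 0%N])) //.
  by rewrite big_seq1 /sscale gbinomE (horner_binom_poly_nat _ 0) mul1r.
by case=> [//|k]; rewrite /sscale gbinomE (horner_binom_poly_nat _ 0) mul0r eqxx.
Qed.

Lemma nboundP (n : nat -> int) : (exists N, forall j, (N <= j)%N -> n j = 0) ->
  forall j, (nbound n <= j)%N -> n j = 0.
Proof. by rewrite /nbound => nN; case: pselect => // N; case: cid. Qed.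

Section ShiftedSeries.
Variable P : lfmonoid mono.
Local Notation B := (hser P R).
Implicit Types (x y u : B) (c : R) (v w m : mono).

Definition series_of v x : series := fun m => x (m - v).

Lemma series_of_inj v : injective (series_of v).
Proof.
move=> x y xy; apply: hserP => m.
by have := congr1 (fun s : series => s (m + v)) xy; rewrite /series_of addrK.
Qed.

Lemma mon_series_of v : Defs.mon v = series_of v 1.
Proof. by apply/funext => m; rewrite /series_of mon_eqE hcoef1 subr_eq0. Qed.

Lemma sone_series_of : sone = series_of 0 1.
Proof. exact: mon_series_of. Qed.

Lemma sscale_series_of c v x : sscale c (series_of v x) = series_of v (c *: x).
Proof. by apply/funext => m; rewrite /series_of hcoefZ. Qed.

Lemma sadd_series_of v x y : sadd (series_of v x) (series_of v y) = series_of v (x + y).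
Proof. by []. Qed.

Lemma smul_series_of v w x y :
  smul (series_of v x) (series_of w y) = series_of (v + w) (x * y).
Proof.
apply/funext => m; rewrite /series_of hcoefM.
have subE p : m - (p + v) - w = m - (v + w) - p.
  by rewrite !opprD !addrA [m - v - w - p]addrAC [m - v - p]addrAC.
rewrite [LHS](fsbig_uniq_supp (s := [seq p + v | p <- divs P (m - (v + w))])).
- rewrite big_map; apply: eq_bigr => p _; rewrite addrK; congr (_ * y _).
  exact: subE.
- by rewrite map_inj_uniq ?divs_uniq // => a b /addIr.
move=> m1; rewrite mulf_eq0 negb_or => /andP[/hcoef_in P1 /hcoef_in P2].
apply/mapP; exists (m1 - v); last by rewrite subrK.
by apply/divsP; split => //; rewrite -subE subrK.
Qed.

Lemma spow_series_of x k : spow (series_of 0 x) k = series_of 0 (x ^+ k).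
Proof.
elim: k => [|k IH]; first exact: sone_series_of.
by rewrite /spow iterS -/(spow _ _) IH smul_series_of addr0 exprS.
Qed.

Lemma ssum_psubst i (a : nat -> R) x (A : nat -> series) : x 0 = 0 ->
  (forall k, (k < i)%N -> a k = 0) ->
  (forall k m, A k m = a (i + k)%N * (x ^+ (i + k)) m) -> ssum A = series_of 0 (psubst a x).
Proof.
move=> x0 a0 AE; apply/funext => m; rewrite /series_of subr0.
rewrite (psubst_widen _ x0 (leq_addl i _)) big_split_ord /= big1 ?add0r => [|k _]; last first.
  by rewrite a0 ?mul0r.
rewrite /ssum (fsbig_uniq_supp (s := index_iota 0 (size (divs P m)))) ?iota_uniq //.
  by rewrite big_mkord; apply: eq_bigr => k _; rewrite AE.
move=> k; rewrite AE mem_index_iota /=; apply: contraTT; rewrite -leqNgt => mk.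
by rewrite hcoefX_eq0 ?mulr0 ?eqxx // (leq_trans mk) ?leq_addl.
Qed.

Lemma binser_series_of a x : x 0 = 0 -> binser a (series_of 0 x) = series_of 0 (hbinom a x).
Proof.
move=> x0; apply: (ssum_psubst (i := 0)) => // k m.
by rewrite spow_series_of sscale_series_of /series_of subr0 hcoefZ gbinomE.
Qed.

Lemma logser_series_of x : x 0 = 0 -> logser (series_of 0 x) = series_of 0 (hlog x).
Proof.
move=> x0; apply: (ssum_psubst (i := 1)) => // [[|//] _|k m].
  by rewrite binom_poly0 coef1.
by rewrite spow_series_of sscale_series_of /series_of subr0 hcoefZ add1n coef1_binom_poly.
Qed.

Lemma geom1_series_of x : x 0 = 0 -> geom1 (series_of 0 x) = series_of 0 (hgeom x).
Proof.
move=> x0; apply: (ssum_psubst (i := 1)) => // [[|//] //|k m].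
by rewrite spow_series_of /series_of subr0 mul1r.
Qed.

Lemma ell_series_of j : P (ell_mono j) -> ell j = series_of 0 (hmon P R (ell_mono j)).
Proof. by move=> Pj; apply/funext => m; rewrite /series_of subr0 hmonE // -mon_eqE. Qed.

Definition zseries c x : series := series_of z_mono (c *: (1 + x)).

Lemma lcoef_zseries c x : x 0 = 0 -> lcoef (zseries c x) = c.
Proof.
by move=> x0; rewrite /lcoef /zseries /series_of subrr hcoefZ hcoefD x0 hcoef1 eqxx addr0 mulr1.
Qed.

Lemma zseries_inj c d x y : 0 < c -> x 0 = 0 -> y 0 = 0 ->
  zseries c x = zseries d y -> c = d /\ x = y.
Proof.
move=> c_gt0 x0 y0 gE; have cd : c = d by rewrite -(lcoef_zseries c x0) gE lcoef_zseries.
split=> //; move/series_of_inj: gE => /(congr1 (GRing.scale c^-1)).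
by rewrite -cd !scalerA mulVf ?gt_eqF // !scale1r => /addrI.
Qed.

Lemma zseries_exists (g : series) c : c != 0 -> g z_mono = c ->
  (forall m, g m != 0 -> P (m - z_mono)) -> exists2 x : B, x 0 = 0 & g = zseries c x.
Proof.
move=> c_gt0 gz gP; pose y : B := hser_of P (fun p => g (p + z_mono)).
have yE p : y p = g (p + z_mono).
  by rewrite hser_ofE // => q Pq; apply: contrapT => /eqP /gP; rewrite addrK.
exists (c^-1 *: y - 1).
  by rewrite hcoefB hcoefZ yE add0r gz hcoef1 eqxx mulVf ?subrr.
apply/funext => m; rewrite /zseries addrC subrK scalerA divff // scale1r.
by rewrite /series_of yE subrK.
Qed.

End ShiftedSeries.

Section ZSeries.
Variables (P : lfmonoid mono) (K : nat).
Hypothesis ellP : forall j, (j < K)%N -> P (ell_mono j).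
Hypothesis levP : forall m, P m -> forall j, (K <= j)%N -> m.2 j = 0.
Local Notation B := (hser P R).
Implicit Types (c : R) (x u : B) (m : mono).

Section Composition.
Variables (c : R) (x : B).
Hypotheses (c_gt0 : 0 < c) (x0 : x 0 = 0).
Local Notation g := (zseries c x).

Lemma eps_zseries : eps g = series_of 0 x.
Proof.
apply/funext => m; rewrite /eps lcoef_zseries // /series_of subr0.
case: pselect => /= [->|/eqP m0]; first by rewrite x0.
have -> : (m.1 + 1, m.2) = m + z_mono.
  by congr pair; apply/funext => j; symmetry; apply: addr0.
rewrite /zseries /series_of addrK hcoefZ hcoefD hcoef1 (negPf m0) add0r.
by rewrite mulrC mulKf // gt_eqF.
Qed.

Lemma delta_zseries j : (j < K)%N -> delta g j = series_of 0 (hdelta c x j).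
Proof.
elim: j => [|j IH] jK /=.
  rewrite eps_zseries lcoef_zseries // logser_series_of // (sone_series_of P).
  rewrite sscale_series_of sadd_series_of (ell_series_of (ellP jK)) smul_series_of addr0.
  by rewrite geom1_series_of // (mon_ellM_coef0 ellP).
rewrite IH ?(ltnW jK) // logser_series_of ?(hdelta_coef0 ellP) ?(ltnW jK) //.
rewrite (ell_series_of (ellP jK)) smul_series_of addr0.
by rewrite geom1_series_of // (mon_ellM_coef0 ellP).
Qed.

Lemma prod_binser_delta_zseries m : (forall j, (K <= j)%N -> m.2 j = 0) ->
  \big[smul/sone]_(j < nbound m.2) binser (m.2 j)%:~R (delta g j) =
  series_of 0 (\prod_(j < K) hbinom (m.2 j)%:~R (hdelta c x j)).
Proof.
move=> mK; pose W j := hbinom (m.2 j)%:~R (hdelta c x j).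
have W1 j : m.2 j = 0 -> W j = 1 by rewrite /W => ->; apply: hbinom0.
have m_nbound : forall j, (nbound m.2 <= j)%N -> m.2 j = 0 by apply: nboundP; exists K.
transitivity (series_of 0 (\prod_(j < nbound m.2) W j)).
  apply: (big_ind2 (fun s w => s = series_of 0 w)) => [|s w s' w' -> ->|j _].
  - exact: sone_series_of.
  - by rewrite smul_series_of addr0.
  have [jK|Kj] := ltnP j K.
    by rewrite delta_zseries // binser_series_of // (hdelta_coef0 ellP).
  by rewrite W1 mK // binser0 (sone_series_of P).
congr series_of; apply: eq_big_ord_idx => j; first by move=> /m_nbound/W1.
by move=> /mK/W1.
Qed.

Lemma mono_comp_zseries m : (forall j, (K <= j)%N -> m.2 j = 0) ->
  mono_comp m g = series_of m (comp_factor K c x m).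
Proof.
move=> mK; rewrite /mono_comp eps_zseries lcoef_zseries // binser_series_of //.
rewrite sscale_series_of (prod_binser_delta_zseries mK) (mon_series_of P m).
by rewrite !smul_series_of !addr0 mul1r -scalerAl.
Qed.

Lemma tcomp_zseries u : tcomp (series_of z_mono u) g = series_of z_mono (zcomp K c x u).
Proof.
apply/funext => m; rewrite /series_of hsubstE.
have level p : P p -> forall j, (K <= j)%N -> (z_mono + p).2 j = 0.
  by move=> Pp j jK; rewrite -[LHS]/(0 + p.2 j) (levP Pp jK) addr0.
rewrite [LHS](fsbig_uniq_supp (s := [seq z_mono + p | p <- divs P (m - z_mono)])).
- rewrite big_map; apply: eq_big_seq => p /divsP[Pp _].
  rewrite mono_comp_zseries; last exact: level.
  by rewrite /series_of [z_mono + p]addrC addrK opprD addrA addrAC.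
- by rewrite map_inj_uniq ?divs_uniq // => a b /addrI.
move=> m1; rewrite mulf_eq0 negb_or => /andP[/hcoef_in P1].
have m1E : m1 = z_mono + (m1 - z_mono) by rewrite addrC subrK.
rewrite mono_comp_zseries; last by rewrite m1E; apply: level.
move=> /hcoef_in P2; rewrite m1E; apply: map_f; apply/divsP; split=> //.
by rewrite opprB addrA subrK.
Qed.

End Composition.

Definition comp_operator (g : series) (T : B -> B) := exists (c : R) (x : B),
  [/\ 0 < c, x 0 = 0, g = zseries c x & T =1 zcomp K c x].

Lemma comp_operator_zseries c x : 0 < c -> x 0 = 0 ->
  comp_operator (zseries c x) (zcomp K c x).
Proof. by move=> c_gt0 x0; exists c, x; split. Qed.

Lemma tcomp_operator g T u : comp_operator g T ->
  tcomp (series_of z_mono u) g = series_of z_mono (T u).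
Proof. by case=> c [x [c_gt0 x0 -> ->]]; apply: tcomp_zseries. Qed.

Lemma comp_operator1 g T : comp_operator g T -> g = series_of z_mono (T 1).
Proof. by case=> c [x [c_gt0 x0 -> ->]]; rewrite zcomp1. Qed.

Lemma comp_operator_inj g T T' : comp_operator g T -> comp_operator g T' -> T =1 T'.
Proof.
case=> c [x [c_gt0 x0 gE TE]] [c' [x' [_ x0' gE' TE']]] u.
have [cc' xx'] : c = c' /\ x = x' by apply: zseries_inj => //; rewrite -gE.
by rewrite TE TE' cc' xx'.
Qed.

Lemma comp_operator_comp g h Tg Th : comp_operator g Tg -> comp_operator h Th ->
  comp_operator (tcomp g h) (Th \o Tg).
Proof.
case=> [c [x [c_gt0 x0 gE TgE]]] opH; have [d [y [d_gt0 y0 hE ThE]]] := opH.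
exists (c * d), (qmul y (hsubst (comp_factor K d y) x)); split.
- exact: mulr_gt0.
- exact: qmul_hcomp_coef0.
- by rewrite gE (tcomp_operator _ opH) ThE (zcomp_affine ellP).
- by move=> u; rewrite /= TgE ThE (zcomp_comp ellP).
Qed.

Lemma comp_operator_id : comp_operator idz id.
Proof.
exists 1, 0; split; [exact: ltr01|exact: hcoef0| |].
  by rewrite /zseries addr0 scale1r; apply: mon_series_of.
by move=> u; rewrite zcomp_id.
Qed.

Lemma comp_operator_iter g T n : comp_operator g T -> comp_operator (iterc n g) (iter n T).
Proof.
move=> opg; elim: n => [|n IH]; first exact: comp_operator_id.
rewrite (_ : iter n.+1 T = iter n T \o T); first exact: comp_operator_comp.
by apply/funext => u; rewrite iterSr.
Qed.

Lemma comp_operator_cancel g g' T T' : comp_operator g T -> comp_operator g' T' ->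
  tcomp g g' = idz -> cancel T T'.
Proof.
move=> opg opg' gg' u; have := comp_operator_comp opg opg'; rewrite gg' => opid.
exact: (comp_operator_inj opid comp_operator_id).
Qed.

End ZSeries.

(** * Neumann's lemma *)

Lemma set_nat_least (U : set nat) :
  U !=set0 -> exists2 n, U n & forall k, U k -> (n <= k)%N.
Proof.
move=> [n Un]; have exn : exists k, `[< U k >] by exists n; apply/asboolP.
by case: (ex_minnP exn) => k /asboolP Uk mink; exists k => // l Ul; apply/mink/asboolP.
Qed.

Record group_order (G : zmodType) := GroupOrder {
  gle :> G -> G -> Prop;
  gle_anti : forall a b, gle a b -> gle b a -> a = b;
  gle_trans : forall b a c, gle a b -> gle b c -> gle a c;
  gle_total : forall a b, gle a b \/ gle b a;
  gleD2r : forall c a b, gle a b -> gle (a + c) (b + c) }.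

Section OrderedGroup.
Variables (G : zmodType) (le : group_order G).
Implicit Types (a b c d x y : G) (A C D S : set G).

Lemma gle_refl a : le a a.
Proof. by case: (gle_total le a a). Qed.

Lemma gnle_ge a b : ~ le a b -> le b a.
Proof. by case: (gle_total le a b). Qed.

Lemma gleD a b c d : le a b -> le c d -> le (a + c) (b + d).
Proof.
move=> /(gleD2r c) ab /(gleD2r b) cd; apply: gle_trans ab _.
by rewrite addrC [b + d]addrC.
Qed.

Lemma gleN2 a b : le a b -> le (- b) (- a).
Proof. by move/(gleD2r (- a - b)); rewrite addrA subrr sub0r addrC subrK. Qed.

Lemma gle_subr_ge0 a b : le a b -> le 0 (b - a).
Proof. by move/(gleD2r (- a)); rewrite subrr. Qed.

Definition wo S := forall A, A `<=` S -> A !=set0 ->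
  exists2 m, A m & forall m', A m' -> le m m'.

Definition descending A := A !=set0 /\ forall x, A x -> exists2 y, A y & ~ le x y.

Lemma woP S : wo S <-> forall A, A `<=` S -> ~ descending A.
Proof.
split=> [woS A AS [A0 Adesc]|nodesc A AS A0].
  by have [m Am minm] := woS A AS A0; have [y /minm] := Adesc m Am.
apply: contrapT => nomin; apply: (nodesc A AS); split=> // x Ax.
apply: contrapT => minx; apply: nomin; exists x => // y Ay.
by apply: contrapT => nxy; apply: minx; exists y.
Qed.

Lemma wo_subset A C : A `<=` C -> wo C -> wo A.
Proof. by move=> AC woC D DA; apply: woC => d /DA /AC. Qed.

Lemma wo_set1 a : wo [set a].
Proof.
move=> D Da [d Dd]; exists d => // d' Dd'.
by rewrite (Da _ Dd) (Da _ Dd'); apply: gle_refl.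
Qed.

Lemma wo_setU A C : wo A -> wo C -> wo (A `|` C).
Proof.
move=> woA woC D DAC D0; have [DA0|nDA] := pselect ((D `&` A) !=set0); last first.
  apply: woC D0 => d Dd; have [Ad|//] := DAC d Dd.
  by case: nDA; exists d.
have [a [Da Aa] mina] := woA (D `&` A) (fun _ h => h.2) DA0.
have [below|nobelow] := pselect ([set d | D d /\ ~ le a d] !=set0); last first.
  by exists a => // d Dd; apply: contrapT => nad; apply: nobelow; exists d.
have [|c [Dc nac] minc] := woC [set d | D d /\ ~ le a d] _ below.
  by move=> d [Dd nad]; have [Ad|//] := DAC d Dd; case: nad; apply: mina.
exists c => // d Dd; have [ad|nad] := pselect (le a d); last exact: minc.
exact: gle_trans (gnle_ge nac) ad.
Qed.

Lemma wo_shift S a : wo S -> wo [set m | S (m + a)].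
Proof.
move=> woS A AS [b Ab]; have [||m Am minm] := woS [set m | A (m - a)].
- by move=> m /AS /=; rewrite subrK.
- by exists (b + a); rewrite /= addrK.
exists (m - a) => // m' Am'; have := minm (m' + a).
by rewrite /= addrK => /(_ Am') /(gleD2r (- a)); rewrite addrK.
Qed.

Lemma descending_records (T : Type) (leT : T -> T -> Prop) (rank : G -> T) D :
  (forall U : set T, U `<=` rank @` D -> U !=set0 ->
     exists2 t, U t & forall t', U t' -> leT t t') ->
  descending D ->
  descending [set x | D x /\ forall y, D y -> le y x -> leT (rank x) (rank y)].
Proof.
move=> wfT [[d0 Dd0] Ddesc]; set R := [set x | _].
have record_below d : D d -> exists2 x, R x & le x d.
  move=> Dd; have [||t [x [Dx xd] <-] mint] := wfT (rank @` [set x | D x /\ le x d]).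
  - by move=> _ [x [Dx _] <-]; exists x.
  - by exists (rank d), d; split=> //; apply: gle_refl.
  exists x => //; split=> // y Dy yx; apply: mint; exists y => //.
  by split=> //; apply: gle_trans yx xd.
split; first by have [x Rx _] := record_below d0 Dd0; exists x.
move=> x [/Ddesc[y Dy nxy] _]; have [r Rr ry] := record_below y Dy.
by exists r => // xr; apply: nxy; apply: gle_trans xr ry.
Qed.

Lemma wo_add A C : wo A -> wo C -> wo [set a + c | a in A & c in C].
Proof.
move=> woA woC; apply/woP => D DAC Ddesc.
have /choice[fst fstP] (d : G) : exists a, D d -> A a /\ C (d - a).
  have [/DAC[a Aa [c Cc <-]]|nDd] := pselect (D d); last by exists 0.
  by exists a => _; rewrite addrC addKr.
have [|R0 Rdesc] := @descending_records _ le fst D _ Ddesc.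
  by move=> U UD; apply: woA => _ /UD[d /fstP[Aa _] <-].
set R := [set x | _] in R0 Rdesc.
have [||_ [x Rx <-] minx] := woC [set d - fst d | d in R].
- by move=> _ [d [/fstP[_ Cc] _] <-].
- by have [d Rd] := R0; exists (d - fst d), d.
have [y Ry nxy] := Rdesc x Rx; apply: (nxy).
rewrite -(subrK (fst x) x) -(subrK (fst y) y).
apply: gleD; first by apply: minx; exists y.
have [_ recx] := Rx; have [Dy _] := Ry.
by apply: recx => //; apply: gnle_ge.
Qed.

Lemma finite_wo_cowo D : wo D ->
  (forall A, A `<=` D -> A !=set0 -> exists2 m, A m & forall a, A a -> le a m) ->
  finite_set D.
Proof.
move=> woD cowoD.
have [->|/set0P D0] := eqVneq D set0; first exact: finite_set0.
have [M DM maxM] := cowoD D (fun _ h => h) D0.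
pose segment x := D `&` [set d | le d x].
suff fin_segment x : D x -> finite_set (segment x).
  by apply: sub_finite_set (fin_segment M DM) => d Dd; split=> //; apply: maxM.
move=> Dx; apply: contrapT => infx; pose X := [set x | D x /\ ~ finite_set (segment x)].
have [_ []//||y [Dy infy] miny] := woD X; first by exists x.
pose E := segment y `\ y.
have infE : ~ finite_set E.
  move=> finE; apply: infy; apply: (@sub_finite_set _ _ (E `|` [set y])).
    by move=> d yd; have [->|] := pselect (d = y); [right|left].
  by rewrite finite_setU.
have /set0P E0 : E != set0 by apply: contra_not_neq infE => ->.
have [m [[Dm my] nmy] maxm] := cowoD E (fun _ h => h.1.1) E0.
apply: nmy; apply: gle_anti my _; apply: miny; split=> // finm; apply: infE.
by apply: sub_finite_set finm => d Ed; split; [case: Ed => -[]|apply: maxm].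
Qed.

Lemma finite_wo_summands A C q : wo A -> wo C -> finite_set [set p | A p /\ C (q - p)].
Proof.
move=> woA woC; apply: finite_wo_cowo => [|E ED [e Ee]].
  by apply: wo_subset woA => p [].
have [|| m Em minm] := woC [set c | E (q - c)].
- by move=> c /ED [_]; rewrite subKr.
- by exists (q - e); rewrite /= subKr.
exists (q - m) => // a Ea; rewrite -[a](subKr q) addrC [q - m]addrC.
by apply/gleD2r/gleN2/minm; rewrite /= subKr.
Qed.

Fixpoint nsum S n : set G :=
  if n is n'.+1 then [set a + b | a in S & b in nsum S n'] else [set 0].

Definition gen_monoid S : set G := \bigcup_n nsum S n.

Lemma gen_monoid0 S : gen_monoid S 0.
Proof. by exists 0%N. Qed.

Lemma sub_gen_monoid S : S `<=` gen_monoid S.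
Proof. by move=> a Sa; exists 1%N => //; exists a => //; exists 0; rewrite ?addr0. Qed.

Lemma gen_monoidD S a b : gen_monoid S a -> gen_monoid S b -> gen_monoid S (a + b).
Proof.
move=> [n _ Sa] [k _ Sb]; exists (n + k)%N => //.
elim: n a Sa => [|n IH] a /=; first by move=> ->; rewrite add0r.
by move=> [s Ss [a' Sa' <-]]; exists s => //; exists (a' + b); rewrite ?addrA //; apply: IH.
Qed.

Lemma gen_monoid_ind S (Q : set G) : Q 0 -> (forall a b, Q a -> Q b -> Q (a + b)) ->
  S `<=` Q -> gen_monoid S `<=` Q.
Proof.
move=> Q0 QD SQ a [n _]; elim: n a => [|n IH] a /=; first by move=> ->.
by move=> [s Ss [b Sb <-]]; apply: QD; [apply: SQ|apply: IH].
Qed.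

Lemma gen_monoid_ge0 S : (forall s, S s -> le 0 s) -> forall x, gen_monoid S x -> le 0 x.
Proof.
move=> S0; apply: (gen_monoid_ind (gle_refl 0)) => // a b a0 b0.
by rewrite -[0]addr0; apply: gleD.
Qed.

(* Suppose the union [bad] of all descending subsets is nonempty, hence descending,
   and restrict it to the sums of fewest generators among the bad elements below
   them. Such an x is s + b with s a generator, and b <= x is not bad, being a
   shorter sum; so these x lie in the sum of two well-ordered sets. *)
Lemma wo_gen_monoid S : wo S -> (forall s, S s -> le 0 s) -> wo (gen_monoid S).
Proof.
move=> woS S0; set M := gen_monoid S.
have M0 := gen_monoid_ge0 S0.
pose bad := [set x | exists A, [/\ A `<=` M, descending A & A x]].
have wo_good : wo (M `\` bad).
  apply/woP => A AMbad Adesc; have [[x Ax] _] := Adesc.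
  by have [_] := AMbad x Ax; apply; exists A; split=> // y /AMbad[].
apply/woP => A AM Adesc; have [[x0 Ax0] _] := Adesc.
have bad_desc : descending bad.
  split; first by exists x0, A.
  by move=> x [E [EM Edesc /(Edesc.2 x)[y Ey nxy]]]; exists y => //; exists E.
have /choice[rank rankP] x :
    exists n, M x -> nsum S n x /\ forall k, nsum S k x -> (n <= k)%N.
  have [[n _ Sx]|nMx] := pselect (M x); last by exists 0%N.
  have [|k Skx mink] := @set_nat_least [set k | nsum S k x]; first by exists n.
  by exists k.
have badM x : bad x -> M x by case=> E [EM _ /EM].
have := descending_records (rank := rank) (fun U _ => @set_nat_least U) bad_desc.
move: ((woP [set a + b | a in S & b in M `\` bad]).1 (wo_add woS wo_good)); apply.
move=> x [badx recx]; have [Sx _] := rankP x (badM x badx).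
case rk: (rank x) Sx => [|n] /=.
  move=> x_eq0; have [E [EM [_ /(_ x)Edesc] Ex]] := badx.
  by have [y /EM/M0] := Edesc Ex; rewrite x_eq0.
move=> [s Ss [b Sb sbx]]; exists s => //; exists b => //; split; first by exists n.
move=> badb; have : (rank x <= rank b)%N.
  by apply: recx => //; rewrite -sbx -[X in le X _]add0r; apply: gleD2r; apply: S0.
by rewrite rk leqNgt ltnS (rankP b (badM b badb)).2.
Qed.

Lemma gen_lfmonoid S : wo S -> (forall s, S s -> le 0 s) ->
  exists P : lfmonoid G, lfm_set P = gen_monoid S.
Proof.
move=> woS S0; have woM := wo_gen_monoid woS S0; have M0 := gen_monoid_ge0 S0.
have pointed a : gen_monoid S a -> gen_monoid S (- a) -> a = 0.
  move=> /M0 a0 /M0 /gleN2; rewrite opprK oppr0 => a0'.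
  exact: gle_anti a0' a0.
by exists (LFMonoid (gen_monoid0 S) (@gen_monoidD S) pointed
  (fun q => finite_wo_summands q woM woM)).
Qed.

End OrderedGroup.

(** * The monoid of the monomials involved *)

Definition mcoord (i : nat) (m : mono) : R := if i is i'.+1 then (m.2 i')%:~R else m.1.

Lemma mcoordD i a b : mcoord i (a + b) = mcoord i a + mcoord i b.
Proof. by case: i => //= i; rewrite -[LHS]/((a.2 i + b.2 i)%:~R) intrD. Qed.

Lemma mcoord_inj a b : (forall i, mcoord i a = mcoord i b) -> a = b.
Proof.
case: a b => [a1 a2] [b1 b2] ab; have := ab 0%N => /= ->; congr pair.
by apply/funext => i; apply: (@intr_inj R); apply: (ab i.+1).
Qed.

Lemma mleP a b : mle a b <->
  a = b \/ exists j, mcoord j a < mcoord j b /\ forall i, (i < j)%N -> mcoord i a = mcoord i b.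
Proof.
case: a b => [a1 a2] [b1 b2]; split.
  case=> /= [lt1|[<- [<-|[j [ltj eqj]]]]]; [by right; exists 0%N|by left|right].
  exists j.+1 => /=; rewrite ltr_int; split => // -[|i] //=.
  by rewrite ltnS => /eqj ->.
case=> [[-> ->]|[[|j] [ltj eqj]]]; first by right; split => //; left.
  by left.
right; split; first exact: (eqj 0%N).
right; exists j; split; first by move: ltj; rewrite /= ltr_int.
by move=> i ij; apply: (@intr_inj R); apply: (eqj i.+1).
Qed.

Lemma mle_total a b : mle a b \/ mle b a.
Proof.
have [/mcoord_inj ->|/existsNP[i /eqP iP]] := pselect (forall i, mcoord i a = mcoord i b).
  by left; apply/mleP; left.
have [|j jne jmin] := @set_nat_least [set i | mcoord i a != mcoord i b]; first by exists i.
have eqj l : (l < j)%N -> mcoord l a = mcoord l b.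
  by move=> lj; apply/eqP/negPn/negP => /jmin; rewrite leqNgt lj.
by move: jne; rewrite /= neq_lt => /orP[lt|lt]; [left|right]; apply/mleP; right; exists j;
  split=> // l /eqj.
Qed.

Lemma mle_anti a b : mle a b -> mle b a -> a = b.
Proof.
move=> /mleP[//|[j [ltj eqj]]] /mleP[//|[i [lti eqi]]].
have [ij|ji|ij] := ltngtP i j.
- by move: lti; rewrite eqj // ltxx.
- by move: ltj; rewrite eqi // ltxx.
- by move: lti; rewrite ij => /(lt_trans ltj); rewrite ltxx.
Qed.

Lemma mle_trans b a c : mle a b -> mle b c -> mle a c.
Proof.
move=> /mleP[->//|[j [ltj eqj]]] /mleP[<-|[i [lti eqi]]]; apply/mleP; right.
  by exists j.
have [ij|ji|ij] := ltngtP i j.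
- exists i; rewrite eqj //; split=> // l li; rewrite eqj ?eqi //; exact: ltn_trans ij.
- exists j; rewrite -eqi //; split=> // l lj; rewrite eqj ?eqi //; exact: ltn_trans ji.
- exists j; rewrite ij in lti eqi; split; first exact: lt_trans ltj lti.
  by move=> l lj; rewrite eqj ?eqi.
Qed.

Lemma mleD2r c a b : mle a b -> mle (a + c) (b + c).
Proof.
move=> /mleP[->|[j [ltj eqj]]]; apply/mleP; [by left|right].
by exists j; rewrite !mcoordD ltrD2r; split=> // i /eqj; rewrite !mcoordD => ->.
Qed.

Definition mono_order : group_order mono :=
  GroupOrder mle_anti mle_trans mle_total mleD2r.

Lemma mle_zexp a b : mle a b -> a.1 <= b.1.
Proof. by case=> [/ltW|[->]]. Qed.

Lemma ell_mono_ge0 j : mle 0 (ell_mono j).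
Proof.
right; split=> //; right; exists j => /=; rewrite eqxx; split=> // i ij.
by rewrite ltn_eqF.
Qed.

Lemma wo_ell_monos (K : nat) : wo mono_order [set ell_mono j | j in `I_K].
Proof.
elim: K => [|K IH]; first by move=> A A0 [a /A0[]].
apply: (wo_subset _ (wo_setU IH (@wo_set1 _ _ (ell_mono K)))).
move=> _ [j + <-]; rewrite /= ltnS leq_eqVlt => /predU1P[->|jK]; first by right.
by left; exists j.
Qed.

Definition mono_monoid (K : nat) (P : lfmonoid mono) :=
  [/\ forall j, (j < K)%N -> P (ell_mono j),
      forall m, P m -> forall j, (K <= j)%N -> m.2 j = 0
    & forall m, P m -> mle 0 m].

Lemma mono_monoid_exists (K : nat) (gs : seq series) :
  (forall g, g \in gs -> InL K g /\ exists c, lead_term_z c g) ->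
  exists2 P : lfmonoid mono, mono_monoid K P &
    forall g m, g \in gs -> g m != 0 -> P (m - z_mono).
Proof.
move=> gsP; pose S g := [set m | Defs.support g (m + z_mono)].
pose gens := [set ell_mono j | j in `I_K] `|` [set m | exists2 g, g \in gs & S g m].
have wo_gens : wo mono_order gens.
  apply: (wo_setU (@wo_ell_monos K)).
  elim: gs gsP {gens} => [|g gs IH] gsP; first by move=> A A0 [a /A0[]].
  have [[_ wog] _] := gsP g (mem_head _ _).
  have woS := @wo_shift _ mono_order _ z_mono wog.
  apply: (wo_subset _ (wo_setU woS
    (IH (fun g' g's => gsP g' (mem_behead (s := g :: gs) g's))))).
  by move=> m [g']; rewrite inE => /predU1P[->|g's] gm; [left|right; exists g'].
have gens_ge0 m : gens m -> mle 0 m.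
  case=> [[j _ <-]|[g /gsP[_ [c [_ gz]]] /gz]]; first exact: ell_mono_ge0.
  by move=> /(@gle_subr_ge0 _ mono_order); rewrite addrK.
have [P PE] := @gen_lfmonoid _ mono_order gens wo_gens gens_ge0.
exists P; rewrite /mono_monoid PE.
  split=> [j jK|m Mm j Kj|]; first by apply: sub_gen_monoid; left; exists j.
    apply: (gen_monoid_ind (Q := [set m | m.2 j = 0])) Mm => //= [a b aj bj|].
      by rewrite -[LHS]/(a.2 j + b.2 j) aj bj.
    move=> t [[i iK <-]|[g /gsP[[gK _] _]]] /=.
      by rewrite gtn_eqF //; apply: leq_trans Kj.
    by move=> /gK[_ /(_ j Kj)]; rewrite -[LHS]/(_.2 j + 0) addr0.
  exact: (@gen_monoid_ge0 _ mono_order).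
by move=> g m gsg gm; apply: sub_gen_monoid; right; exists g; rewrite // /S /= subrK.
Qed.

Lemma common_zseries (K : nat) (gs : seq series) :
  (forall g, g \in gs -> InL K g /\ exists c, lead_term_z c g) ->
  exists2 P : lfmonoid mono, mono_monoid K P &
    forall g c, g \in gs -> 0 < c -> lead_term_z c g ->
      exists2 x : hser P R, x 0 = 0 & g = zseries c x.
Proof.
move=> /mono_monoid_exists[P PK gP]; exists P => // g c gsg c_gt0 [gc _].
by apply: zseries_exists; rewrite ?gt_eqF // => m; apply: gP.
Qed.

Lemma tcomp_zseries_least (K : nat) (P : lfmonoid mono) (c : R) (x : hser P R)
    (F : series) (m : mono) : mono_monoid K P -> 0 < c -> x 0 = 0 -> InL K F ->
  F m != 0 -> (forall m', F m' != 0 -> mle m m') ->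
  tcomp F (zseries c x) m = F m * Rpower c m.1.
Proof.
move=> [ellP _ P0] c_gt0 x0 [FK _] Fm minm.
have levF m' : F m' != 0 -> forall j, (K <= j)%N -> m'.2 j = 0 by move=> /FK[].
rewrite /tcomp (fsbig_uniq_supp (s := [:: m])) // => [|m'].
  rewrite big_seq1 (mono_comp_zseries ellP c_gt0 x0 (levF m Fm)).
  by rewrite /series_of subrr (comp_factor_coef0 ellP).
rewrite inE mulf_eq0 negb_or => /andP[Fm'].
rewrite (mono_comp_zseries ellP c_gt0 x0 (levF m' Fm')) => /hcoef_in/P0/(mleD2r m').
by rewrite add0r subrK => m'm; apply/eqP/mle_anti => //; apply: minm.
Qed.

Lemma lead_term_left_inverse (K : nat) (c : R) (g F : series) : 0 < c ->
  InL K g -> lead_term_z c g -> InL K F -> tcomp F g = idz -> lead_term_z c^-1 F.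
Proof.
move=> c_gt0 gL gz FL Fg; have [|P PK gsP] := @common_zseries K [:: g].
  by move=> g'; rewrite inE => /eqP ->; split=> //; exists c.
have [x x0 gE] := gsP g c (mem_head _ _) c_gt0 gz.
have F0 : Defs.support F !=set0.
  apply: contrapT => noF; have := congr1 (fun s : series => s z_mono) Fg.
  rewrite [RHS](mon_eqE z_mono) eqxx /tcomp fsbig1 => [/eqP|m _]; first by rewrite eq_sym oner_eq0.
  by have /negPn/eqP-> : ~~ (F m != 0); rewrite ?mul0r //; apply/negP => Fm; apply: noF; exists m.
have [m Fm minm] := FL.2 _ (fun _ h => h) F0.
have := tcomp_zseries_least PK c_gt0 x0 FL Fm minm; rewrite -gE Fg [idz m](mon_eqE z_mono).
have [mz|_ /esym/eqP] := eqVneq m z_mono; last first.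
  by rewrite mulf_eq0 (negPf Fm) gt_eqF //; apply/RltP/exp_pos.
rewrite mz Rpower_1; last exact/RltP.
move=> Fz; split; last by rewrite -/z_mono -mz.
by rewrite -/z_mono -[LHS](mulfK (_ : c != 0)) ?gt_eqF // -Fz div1r.
Qed.

(** * Convergence of iterated conjugates *)

Lemma Un_cvP (u : nat -> R) (l : R) :
  Un_cv u l <-> forall e : R, 0 < e -> exists N, forall n, (N <= n)%N -> `|u n - l| < e.
Proof.
split=> cvu e /RltP e0; have [N uN] := cvu e e0; exists N => n /ssrnat.leP Nn.
  by apply/RltP; rewrite -RdistE; apply: uN.
by have /RltP := uN n Nn; rewrite -RdistE.
Qed.

Lemma Un_cv_cst (c : R) : Un_cv (fun=> c) c.
Proof. by apply/Un_cvP => e e0; exists 0%N => n _; rewrite subrr normr0. Qed.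

Lemma Un_cv0D (u v : nat -> R) : Un_cv u 0 -> Un_cv v 0 -> Un_cv (fun n => u n + v n) 0.
Proof. by move=> u0 v0; have := CV_plus _ _ _ _ u0 v0; rewrite RplusE addr0. Qed.

Lemma Un_cv0Ml (c : R) (u : nat -> R) : Un_cv u 0 -> Un_cv (fun n => c * u n) 0.
Proof. by move=> u0; have := CV_mult _ _ _ _ (Un_cv_cst c) u0; rewrite RmultE mulr0. Qed.

Lemma Un_cv0_sum (I : eqType) (s : seq I) (Q : pred I) (u : I -> nat -> R) :
  (forall i, i \in s -> Q i -> Un_cv (u i) 0) -> Un_cv (fun n => \sum_(i <- s | Q i) u i n) 0.
Proof.
elim: s => [|i s IH] cvu.
  by apply: (Un_cv_ext (fun=> 0)) (Un_cv_cst 0) => n; rewrite big_nil.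
have cvs : Un_cv (fun n => \sum_(j <- s | Q j) u j n) 0.
  by apply: IH => j sj; apply: cvu; rewrite inE sj orbT.
have [Qi|nQi] := boolP (Q i).
  apply: Un_cv_ext (Un_cv0D (cvu i (mem_head _ _) Qi) cvs) => n.
  by rewrite big_cons Qi.
by apply: Un_cv_ext cvs => n; rewrite big_cons (negPf nQi).
Qed.

Lemma Un_cv0X (q : R) : 0 <= q < 1 -> Un_cv (GRing.exp q) 0.
Proof.
move=> /andP[q0 q1]; apply/Un_cvP => e /RltP e0.
have absq : Rlt (Rabs q) 1 by apply/RltP; rewrite RabsE ger0_norm.
have [N qN] := pow_lt_1_zero q absq e e0; exists N => n /ssrnat.leP Nn.
by rewrite subr0; have /RltP := qN n Nn; rewrite RabsE RpowE.
Qed.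

Lemma Un_cv0_linear_rec (q : R) (u e : nat -> R) : 0 <= q < 1 -> Un_cv e 0 ->
  (forall n, u n.+1 = q * u n + e n) -> Un_cv u 0.
Proof.
move=> q01 /Un_cvP cve uS; have /andP[q0 q1] := q01; apply/Un_cvP => d d0.
have tol0 : 0 < d * (1 - q) / 2 by rewrite divr_gt0 // mulr_gt0 // subr_gt0.
have [N eN] := cve _ tol0.
have bound k : `|u (N + k)%N| <= `|u N| * q ^+ k + d / 2.
  elim: k => [|k IH]; first by rewrite addn0 expr0 mulr1; lra.
  rewrite addnS uS exprS; apply: le_trans (ler_normD _ _) _; rewrite normrM (ger0_norm q0).
  have := eN (N + k)%N (leq_addr _ _); rewrite subr0 => /ltW /(lerD (ler_wpM2l q0 IH)) h.
  by apply: le_trans h _; rewrite le_eqVlt; apply/orP; left; apply/eqP; field.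
have d2 : 0 < d / 2 by lra.
have [M qM] := (Un_cvP _ _).1 (Un_cv0Ml `|u N| (Un_cv0X q01)) _ d2.
exists (N + M)%N => n NMn; have -> : n = (N + (n - N))%N by lia.
have := qM (n - N)%N ltac:(lia).
rewrite !subr0 ger0_norm ?mulr_ge0 ?exprn_ge0 // => qn.
by apply: le_lt_trans (bound _) _; lra.
Qed.

Lemma conj_symbol_cv0 (G : zmodType) (P : lfmonoid G) (a b e : G -> hser P R) :
  (forall d, (forall p s, s \in divs P d -> e p s = 0) \/
             (forall p, 0 <= b p 0 * a (p + d) 0 < 1)) ->
  forall p d, Un_cv (fun n => conj_symbol a b e n p d) 0.
Proof.
move=> dich p d; have [N] := ubnP (size (divs P d)); elim: N p d => // N IH p d szN.
have [Pd|nPd] := pselect (P d); last first.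
  by apply: (Un_cv_ext (fun=> 0)) (Un_cv_cst 0) => n; rewrite hcoef_out.
have [e0|ratio] := dich d.
  apply: (Un_cv_ext (fun=> 0)) (Un_cv_cst 0) => n.
  by rewrite conj_symbol_minimal => [|q s sd _]; rewrite e0 ?divs_refl ?mulr0.
apply: (Un_cv0_linear_rec (ratio p) _ (fun n => conj_symbol_rec a b e n p d)).
apply: Un_cv0_sum => s sd _; apply: Un_cv0_sum => r rs srd.
have cvt : Un_cv (fun n => conj_symbol a b e n (p + r) (s - r)) 0.
  apply: IH; have tsd := divs_trans (divs_subr rs) sd.
  by apply: leq_trans (ltn_size_divs tsd srd) _; rewrite -ltnS.
apply: Un_cv_ext (Un_cv0Ml (b p r * a (p + s) (d - s)) cvt) => n.
by rewrite mulrAC.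
Qed.

(** * The generalized Koenigs sequence *)

Lemma Un_cv_subr0 (u : nat -> R) (l : R) : Un_cv u l <-> Un_cv (fun n => u n - l) 0.
Proof.
by split=> /Un_cvP cvu; apply/Un_cvP => e /cvu[N uN]; exists N => n /uN; rewrite subr0.
Qed.

Lemma Rpower_invMr (c s t : R) : 0 < c -> Rpower c^-1 s * Rpower c t = Rpower c (t - s).
Proof.
move=> /RltP c_gt0; rewrite /Rpower -[c^-1]/(Rinv c) ln_Rinv // -[_ * _]exp_plus.
by congr exp; rewrite !(RplusE, RminusE, RmultE, RoppE); ring.
Qed.

Lemma Rpower_lt1 (c t : R) : 0 < c < 1 -> 0 < t -> Rpower c t < 1.
Proof.
move=> /andP[/RltP c_gt0 /RltP c1] t0; apply/RltP; rewrite /Rpower -[X in Rlt _ X]exp_0.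
apply: exp_increasing; apply/RltP; rewrite RmultE pmulr_rlt0 //; apply/RltP.
by rewrite -[X in Rlt _ X]ln_1; apply: ln_increasing.
Qed.

Lemma iter_raddfB (V : zmodType) (f : {additive V -> V}) n u v :
  iter n f (u - v) = iter n f u - iter n f v.
Proof. by elim: n => //= n ->; rewrite raddfB. Qed.

Lemma iter_sandwich (T : Type) (f g c : T -> T) :
  (forall u, f (g (c u)) = g u) -> forall n u, iter n f (g (iter n c u)) = g u.
Proof. by move=> fgc; elim=> // n IH u; rewrite iterS [iter _ c _]iterSr IH fgc. Qed.

Definition koenigs (f0inv h f : series) (n : nat) : series :=
  tcomp (iterc n f0inv) (tcomp h (iterc n f)).

Section KoenigsSequence.
Variables (K : nat) (P : lfmonoid mono) (lam : R) (xf xi xh xp : hser P R).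
Hypotheses (PK : mono_monoid K P) (lam01 : 0 < lam < 1).
Hypotheses (xf0 : xf 0 = 0) (xi0 : xi 0 = 0) (xh0 : xh 0 = 0) (xp0 : xp 0 = 0).
Local Notation Tf := (zcomp K lam xf).
Local Notation Ti := (zcomp K lam^-1 xi).
Local Notation Th := (zcomp K 1 xh).
Local Notation Tp := (zcomp K 1 xp).
Local Notation koenigs_seq := (koenigs (zseries lam^-1 xi) (zseries 1 xh) (zseries lam xf)).
Hypothesis TfTpTi : forall u, Tf (Tp (Ti u)) = Tp u.

Let a (p : mono) := comp_factor K lam xf (z_mono + p).
Let b (p : mono) := comp_factor K lam^-1 xi (z_mono + p).
Let e (p : mono) := comp_factor K 1 xh (z_mono + p) - comp_factor K 1 xp (z_mono + p).
Local Notation error n := (conj_symbol a b e n 0).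

Let lam_gt0 : 0 < lam. Proof. by case/andP: lam01. Qed.
Let ellP : forall j, (j < K)%N -> P (ell_mono j). Proof. by case: PK. Qed.

Lemma koenigs_error n q : koenigs_seq n q - zseries 1 xp q = error n (q - z_mono).
Proof.
have levP : forall m, P m -> forall j, (K <= j)%N -> m.2 j = 0 by case: PK.
have opf := comp_operator_zseries K lam_gt0 xf0.
have opi : comp_operator K (zseries lam^-1 xi) Ti.
  by apply: comp_operator_zseries; rewrite ?invr_gt0.
have oph := comp_operator_zseries K ltr01 xh0.
have opp := comp_operator_zseries K ltr01 xp0.
have opn := comp_operator_comp ellP levP oph (comp_operator_iter ellP levP n opf).
rewrite /koenigs (comp_operator1 (comp_operator_iter ellP levP n opi)).
rewrite (tcomp_operator ellP levP _ opn) (comp_operator1 opp).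
have errorE : error n = iter n Tf (Th (iter n Ti 1)) - iter n Tf (Tp (iter n Ti 1)).
  rewrite -[LHS]hsubst1 hsubst_conj_symbol -(iter_raddfB (hsubst a)).
  by congr (iter n _ _); apply: hsubstB.
by rewrite -[Tp 1](iter_sandwich TfTpTi n) errorE.
Qed.

Lemma error_ratio p d : b p 0 * a (p + d) 0 = Rpower lam d.1.
Proof.
have bE : b p 0 = Rpower lam^-1 (z_mono + p).1 := comp_factor_coef0 ellP lam^-1 _ xi0.
have aE : a (p + d) 0 = Rpower lam (z_mono + (p + d)).1 := comp_factor_coef0 ellP lam _ xf0.
rewrite (congr2 *%R bE aE) Rpower_invMr //; congr Rpower.
by rewrite -[LHS]/((1 + (p.1 + d.1)) - (1 + p.1)); ring.
Qed.

Lemma error_symbol_eq0 p d : eq_below d xh xp -> forall s, s \in divs P d -> e p s = 0.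
Proof.
move=> hp s sd; rewrite /e hcoefB; apply/eqP; rewrite subr_eq0; apply/eqP.
exact: (eq_below_comp_factor K _ _ hp).
Qed.

Lemma divs_zexp s d : s \in divs P d -> s.1 <= d.1.
Proof.
have [_ _ P0] := PK.
by move=> /divsP[_ /P0/mle_zexp]; rewrite -[X in _ <= X]/(d.1 - s.1) subr_ge0.
Qed.

Lemma koenigs_cvg : (forall m, xh m != xp m -> 0 < m.1) ->
  weak_cvg K koenigs_seq (zseries 1 xp).
Proof.
move=> hp c n _ _; apply/Un_cv_subr0.
apply: Un_cv_ext (conj_symbol_cv0 (a := a) (b := b) (e := e) _ 0 ((c, n) - z_mono)) => [N|d].
  by rewrite koenigs_error.
have [d0|d0] := ltP 0 d.1; [right|left] => p.
  rewrite error_ratio Rpower_lt1 // andbT.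
  by apply/ltW/RltP/exp_pos.
apply: error_symbol_eq0 => s /divs_zexp sd; apply/eqP; apply: contraTT d0 => /hp s0.
by rewrite -ltNge (lt_le_trans s0).
Qed.

Lemma error_least d n : xh d != xp d -> d.1 = 0 ->
  (forall s, s \in divs P d -> s != d -> xh s = xp s) -> error n d = xh d - xp d.
Proof.
move=> hpd d0 hp; rewrite conj_symbol_minimal => [|q s sd snd].
  rewrite error_ratio d0 Rpower_O; last exact/RltP.
  rewrite expr1n mul1r hcoefB addr0 !comp_factor_z ?ltr01 //.
  by rewrite !scale1r !hcoefD opprD addrACA subrr add0r.
apply: error_symbol_eq0 (divs_refl _) => [r rs|]; last by case/divsP: sd.
apply: hp; first exact: divs_trans rs sd.
by apply: contraNneq snd => rd; apply/eqP/(divs_anti sd); rewrite -rd.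
Qed.

Lemma koenigs_cvg_inv : weak_cvg K koenigs_seq (zseries 1 xp) ->
  forall m, xh m != xp m -> 0 < m.1.
Proof.
have [_ levP P0] := PK; move=> cvg m hpm; rewrite ltNge; apply/negP => m0.
pose bad d := xh d != xp d /\ d.1 <= 0.
have [|_ [d [hpd d0] <-] mind] := @set_nat_least [set size (divs P d) | d in bad].
  by exists (size (divs P m)), m.
have Pd : P d by apply: (@hcoef_in _ P _ (xh - xp)); rewrite hcoefB subr_eq0.
have dz : d.1 = 0 by apply/le_anti; rewrite d0 (mle_zexp (P0 d Pd)).
have least s : s \in divs P d -> s != d -> xh s = xp s.
  move=> sd snd; apply/eqP; apply: contraTT (ltn_size_divs sd snd) => hps.
  by rewrite -leqNgt; apply: mind; exists s; split=> //; apply: le_trans (divs_zexp sd) d0.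
have cv0 : Un_cv (fun n => error n d) 0.
  have dz0 : 0 <= (d + z_mono).1 by rewrite -[X in _ <= X]/(d.1 + 1) dz add0r ler01.
  have dzK j : (K <= j)%N -> (d + z_mono).2 j = 0.
    by move=> Kj; rewrite -[LHS]/(d.2 j + 0) (levP d Pd) ?addr0.
  apply: Un_cv_ext ((Un_cv_subr0 _ _).1 (cvg _ _ dz0 dzK)) => n.
  by rewrite -surjective_pairing koenigs_error addrK.
have cvd := Un_cv_ext _ _ (fun n => error_least n hpd dz least) _ cv0.
have /eqP := UL_sequence _ _ _ cvd (Un_cv_cst _).
by rewrite eq_sym subr_eq0 (negPf hpd).
Qed.

End KoenigsSequence.

Lemma leading_block_parabolic (f : series) m : parabolic f ->
  leading_block f m = if m.1 <= 1 then f m else 0.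
Proof.
move=> [f1 fz]; rewrite /leading_block; case: pselect => /= minm.
  by rewrite (minm z_mono) // [f z_mono]f1 oner_eq0.
case: ifP => // m1; case: minm => m' /fz/mle_zexp; exact: le_trans.
Qed.

Lemma eq_leading_block (g h : series) : parabolic g -> parabolic h ->
  leading_block g = leading_block h <-> forall m, m.1 <= 1 -> g m = h m.
Proof.
move=> pg ph; split=> [gh m m1|gh].
  by have := congr1 (fun s : series => s m) gh; rewrite !leading_block_parabolic // m1.
by apply/funext => m; rewrite !leading_block_parabolic //; case: ifP => // /gh.
Qed.

Lemma eq_leading_block_zseries (P : lfmonoid mono) (x y : hser P R) :
  parabolic (zseries 1 x) -> parabolic (zseries 1 y) ->
  leading_block (zseries 1 x) = leading_block (zseries 1 y) <->
  forall m, x m != y m -> 0 < m.1.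
Proof.
move=> px py; apply: (iff_trans (eq_leading_block px py)).
have eqE m : (zseries 1 x m == zseries 1 y m) = (x (m - z_mono) == y (m - z_mono)).
  by rewrite /zseries /series_of !scale1r !hcoefD (inj_eq (addrI _)).
have subE m : (m - z_mono).1 = m.1 - 1 by [].
split=> xy m => [|m1].
  apply: contraNT; rewrite -leNgt -(addrK z_mono m) subE subr_le0 => /xy/eqP.
  by rewrite eqE.
by apply/eqP; rewrite eqE; apply: contraLR m1 => /xy; rewrite subE subr_gt0 -ltNge.
Qed.

Lemma zcomp_sandwich (K : nat) (P : lfmonoid mono) (f f0 f0inv phi phiinv : series)
    (Tf T0 Ti Tp Tq : hser P R -> hser P R) : mono_monoid K P ->
  comp_operator K f Tf -> comp_operator K f0 T0 -> comp_operator K f0inv Ti ->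
  comp_operator K phi Tp -> comp_operator K phiinv Tq ->
  tcomp f0inv f0 = idz -> tcomp phiinv phi = idz -> tcomp (tcomp phi f) phiinv = f0 ->
  forall u, Tf (Tp (Ti u)) = Tp u.
Proof.
move=> [ellP levP _] opf op0 opi opp opq iK qK conj u.
have T0E : T0 =1 Tq \o (Tf \o Tp).
  apply: (comp_operator_inj op0); rewrite -conj.
  by do !apply: comp_operator_comp.
rewrite -[LHS](comp_operator_cancel ellP levP opq opp qK) -[Tq _]T0E.
by rewrite (comp_operator_cancel ellP levP opi op0 iK).
Qed.

Theorem koenigs_weak_cvg (K : nat) (lam : R) (f f0 f0inv phi phiinv h : series) :
  0 < lam < 1 -> InL K f -> lead_term_z lam f -> InL K f0 -> lead_term_z lam f0 ->
  InL K f0inv -> tcomp f0inv f0 = idz ->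
  InL K phi -> parabolic phi -> InL K phiinv -> tcomp phiinv phi = idz ->
  tcomp (tcomp phi f) phiinv = f0 -> InL K h -> parabolic h ->
  weak_cvg K (koenigs f0inv h f) phi <-> leading_block h = leading_block phi.
Proof.
move=> lam01 fL f_lead f0L f0_lead f0invL f0invK.
move=> phiL phi_lead phiinvL phiinvK phi_conj hL h_lead; have /andP[lam_gt0 _] := lam01.
have laminv_gt0 : 0 < lam^-1 by rewrite invr_gt0.
have f0inv_lead : lead_term_z lam^-1 f0inv.
  exact: lead_term_left_inverse f0L f0_lead f0invL f0invK.
have phiinv_lead : parabolic phiinv.
  by have := lead_term_left_inverse ltr01 phiL phi_lead phiinvL phiinvK; rewrite invr1.
have [|P PK gsP] := @common_zseries K [:: f; f0; f0inv; phi; phiinv; h].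
  move=> g; rewrite !inE => /or4P[/eqP->|/eqP->|/eqP->|/or3P[]/eqP->]; split=> //;
    by [exists lam|exists lam|exists lam^-1|exists 1|exists 1|exists 1].
have [|xf xf0 fE] := gsP f lam _ lam_gt0 f_lead; first by rewrite !inE eqxx.
have [|xn xn0 f0E] := gsP f0 lam _ lam_gt0 f0_lead; first by rewrite !inE eqxx ?orbT.
have [|xi xi0 f0invE] := gsP f0inv _ _ laminv_gt0 f0inv_lead; first by rewrite !inE eqxx ?orbT.
have [|xp xp0 phiE] := gsP phi 1 _ ltr01 phi_lead; first by rewrite !inE eqxx ?orbT.
have [|xq xq0 phiinvE] := gsP phiinv 1 _ ltr01 phiinv_lead; first by rewrite !inE eqxx ?orbT.
have [|xh xh0 hE] := gsP h 1 _ ltr01 h_lead; first by rewrite !inE eqxx ?orbT.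
rewrite {}fE {}f0E {}f0invE {}phiE {}phiinvE {}hE in phi_lead h_lead f0invK phiinvK phi_conj *.
have [opf op0] := (comp_operator_zseries K lam_gt0 xf0, comp_operator_zseries K lam_gt0 xn0).
have opi := comp_operator_zseries K laminv_gt0 xi0.
have [opp opq] := (comp_operator_zseries K ltr01 xp0, comp_operator_zseries K ltr01 xq0).
have sandwich := zcomp_sandwich PK opf op0 opi opp opq f0invK phiinvK phi_conj.
rewrite (eq_leading_block_zseries h_lead phi_lead); split; first exact: koenigs_cvg_inv.
exact: koenigs_cvg.
Qed.

Lemma InL_leq (k K : nat) (f : series) : (k <= K)%N -> InL k f -> InL K f.
Proof.
move=> kK [fk wof]; split=> // m /fk[m0 mk]; split=> // j Kj.
exact/mk/(leq_trans kK).
Qed.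

Lemma normal_form_neq0 k (f : series) m : normal_form k f m != 0 -> f m != 0.
Proof. by rewrite /normal_form; case: pselect => //=; rewrite eqxx. Qed.

Lemma InL_normal_form (k K : nat) (f : series) : InL K f -> InL K (normal_form k f).
Proof.
move=> [fK wof]; split=> [m /normal_form_neq0/fK //|].
by apply: (@wo_subset _ mono_order _ _ _ wof) => m; apply: normal_form_neq0.
Qed.

Lemma lead_term_normal_form k (c : R) (f : series) :
  lead_term_z c f -> lead_term_z c (normal_form k f).
Proof.
move=> [fc fz]; split=> [|m /normal_form_neq0/fz //].
rewrite /normal_form; case: pselect => //= -[]; split=> //; split=> //; split; first by left.
by case: k => [|k]; [left|right; exists 0%N].
Qed.

Theorem mainTheorem3 (k : nat) (lam : R) (f f0inv phi phiinv : series)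
  (m : nat) (h : series) :
  InL k f -> 0 < lam < 1 -> lead_term_z lam f ->
  (* f0inv is the compositional inverse of the normal form f_0 *)
  InL k f0inv ->
  tcomp (normal_form k f) f0inv = idz -> tcomp f0inv (normal_form k f) = idz ->
  (* phi in L_k^0 with phi o f o phi^{-1} = f_0 *)
  InL k phi -> parabolic phi ->
  InL k phiinv -> tcomp phi phiinv = idz -> tcomp phiinv phi = idz ->
  tcomp (tcomp phi f) phiinv = normal_form k f ->
  (* h in L_m^0 *)
  InL m h -> parabolic h ->
  (weak_cvg (maxn k m)
     (fun n => tcomp (iterc n f0inv) (tcomp h (iterc n f))) phi
   <-> leading_block h = leading_block phi).
Proof.
move=> fL lam01 f_lead f0invL _ f0invK phiL phi_lead phiinvL _ phiinvK phi_conj hL h_lead.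
have kK := InL_leq (leq_maxl k m).
apply: (koenigs_weak_cvg lam01 (kK _ fL) f_lead _ _ (kK _ f0invL) f0invK
  (kK _ phiL) phi_lead (kK _ phiinvL) phiinvK phi_conj) => //.
- exact/InL_normal_form/kK.
- exact: lead_term_normal_form.
- exact: InL_leq (leq_maxr k m) hL.
Qed.
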